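(* Let $t \geq 2$ be an integer and $G$ a graph. If $G$ contains no odd $K_t$ minor and $G$ contains a bipartite $K_{2t-2}+I_t$ subdivision, then there is $X \subseteq V(G)$ with $|X| \leq 2t-4$ such that $G \setminus X$ has a bipartite block with at least $t+3$ vertices.
   Context: All graphs are finite and simple. $K_s + I_t$ is the graph obtained from the disjoint union of $K_s$ and the edgeless graph $I_t$ on $t$ vertices by joining every vertex of $K_s$ to every vertex of $I_t$. A graph contains a bipartite $H$ subdivision if it has a subgraph that is bipartite and is obtained from $H$ by replacing edges by internally disjoint paths. A block is a maximal connected subgraph without a cut vertex. A graph $G$ contains $K_t$ as an odd minor if there exist vertex-disjoint trees $\{T_u\}_{u\in V(K_t)}$ in $G$ and a coloring $\alpha:\bigcup_u V(T_u)\to\{1,2\}$ such that every edge of each $T_u$ has ends of different colors and for every pair $v\ne w$ there is an edge of $G$ joining $V(T_v)$ and $V(T_w)$ whose ends have the same color. *)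

(* Defs.v *)
(* A finite simple graph is (T, e) with T : finType and
   e : rel T symmetric and irreflexive (these are hypotheses of the theorem). *)
From mathcomp Require Import all_boot.
Set Implicit Arguments. Unset Strict Implicit. Unset Printing Implicit Defensive.

Section Graphs.
Variable T : finType.

Definition restr (r : rel T) (S : {set T}) : rel T :=
  [rel x y | [&& x \in S, y \in S & r x y]].

(* the subgraph (S, r restricted to S) is connected (vacuous for S = set0) *)
Definition connected_on (r : rel T) (S : {set T}) : Prop :=
  forall x y, x \in S -> y \in S -> connect (restr r S) x y.

Definition is_tree (S : {set T}) (F : rel T) : Prop :=
  [/\ S != set0,
      (forall x y, F x y -> (x \in S) && (y \in S)),
      (forall x y, F x y = F y x),
      connected_on F S
    & ~ (exists c : seq T, [/\ 3 <= size c, uniq c & cycle F c])].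

Definition tree_in (e : rel T) (S : {set T}) (F : rel T) : Prop :=
  is_tree S F /\ (forall x y, F x y -> e x y).

Definition odd_Kt_minor (e : rel T) (t : nat) : Prop :=
  exists (S : 'I_t -> {set T}) (F : 'I_t -> rel T) (alpha : T -> bool),
  [/\ (forall u, tree_in e (S u) (F u)),
      (forall u v, u != v -> [disjoint S u & S v]),
      (forall u x y, F u x y -> alpha x != alpha y)
    & (forall u v, u != v ->
         exists x y, [/\ x \in S u, y \in S v, e x y & alpha x == alpha y])].

End Graphs.

Definition KI_vertex (s t : nat) : finType := ('I_s + 'I_t)%type.

Definition is_inl (A B : Type) (x : A + B) : bool :=
  if x is inl _ then true else false.

Definition KI_adj (s t : nat) : rel (KI_vertex s t) :=
  fun a b => (a != b) && (is_inl a || is_inl b).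

Section Subdiv.
Variables (T V : finType).

(* G = (T, e) contains a bipartite subdivision of H = (V, hadj), hadj symmetric.
   phi maps branch vertices injectively; P a b is the sequence of internal
   vertices of the path replacing edge ab (P b a is its reverse); paths are
   simple, their internal vertices avoid branch vertices, internal vertex sets
   of distinct edges are disjoint; c is a proper 2-colouring of the union of
   the paths (i.e. the subdivision subgraph is bipartite). *)
Definition bip_subdivision (e : rel T) (hadj : rel V) : Prop :=
  exists (phi : V -> T) (P : V -> V -> seq T) (c : T -> bool),
  [/\ injective phi,
      (forall a b, hadj a b ->
        [/\ path e (phi a) (rcons (P a b) (phi b)),
            uniq (phi a :: rcons (P a b) (phi b)),
            P b a = rev (P a b),
            (forall x, x \in P a b -> x \notin codom phi)
          & path (fun x y => c x != c y) (phi a) (rcons (P a b) (phi b))])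
    & (forall a b a' b', hadj a b -> hadj a' b' ->
         ~~ (((a == a') && (b == b')) || ((a == b') && (b == a'))) ->
         forall x, x \in P a b -> x \notin P a' b')].

End Subdiv.

Section Blocks.
Variable T : finType.

(* no cut vertex in the induced subgraph G[B] (assumed connected) *)
Definition no_cut_vertex (e : rel T) (B : {set T}) : Prop :=
  forall v, v \in B -> connected_on e (B :\ v).

(* B is (the vertex set of) a block of G \ X, i.e. of G[~: X]: a maximal
   vertex set inducing a nonempty connected subgraph without cut vertex.
   (Blocks are induced subgraphs, so maximality over vertex sets is
   equivalent to maximality over subgraphs.) *)
Definition is_block_minus (e : rel T) (X B : {set T}) : Prop :=
  [/\ B \subset ~: X, B != set0, connected_on e B, no_cut_vertex e B
    & forall B' : {set T}, B \subset B' -> B' \subset ~: X ->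
        connected_on e B' -> no_cut_vertex e B' -> B' = B].

Definition bipartite_on (e : rel T) (B : {set T}) : Prop :=
  exists c : T -> bool, forall x y, x \in B -> y \in B -> e x y -> c x != c y.

End Blocks.

(* Main.v *)
(* Call a path between two branch vertices breaking if its length has the wrong
   parity for the 2-colouring [c] of the subdivision.

   Duality: either there are [t - 1] disjoint breaking paths, or at most [2t - 4]
   vertices meet all of them. This is Gallai's lemma (the hard half of the Tutte-Berge
   formula) applied to two linked copies of the graph, in which breaking paths are the
   augmenting paths of the matching made of the links.

   In the first case choose the paths with as few edges outside the subdivision as
   possible. They use at most [2t - 2] of the [3t - 2] branch vertices, and by
   minimality a subdivided edge leaving an unused branch vertex meets the paths for the
   first time on the path ending at its other end. A breaking path, 2-coloured properly,
   agrees with [c] at one end and disagrees at the other. Attach to each path an unused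
   vertex, coloured against [c], through the disagreeing end; it sees the agreeing ends
   of the other trees through monochromatic edges. The remaining unused vertex, coloured
   by [c], is the last tree of an odd [K_t] minor.

   In the second case the subdivision still contains, outside the hitting set, a graph
   without cut vertex on at least [t + 3] vertices, because any two surviving branch
   vertices were joined by [2t - 2] internally disjoint routes. In the block around it
   all paths between two branch vertices have the right parity, and a set on which [c]
   extends and whose pairs are linked to these two vertices grows by ears until it is
   the whole block, which is therefore bipartite. *)
Require Import Defs.
From mathcomp Require Import all_boot zify.
From Stdlib Require Import Classical.
Set Implicit Arguments. Unset Strict Implicit. Unset Printing Implicit Defensive.

(** * Extremal choices and the parity of involutions *)

Lemma ex_min_measure (S : Type) (P : S -> Prop) (m : S -> nat) :
  (exists x, P x) -> exists x, P x /\ forall y, P y -> m x <= m y.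
Proof.
case=> x Px; have [n le_mn] := ubnP (m x).
elim: n => // n IHn in x Px le_mn *.
case: (classic (exists y, P y /\ m y < m x)) => [[y [Py lt_yx]]|noy].
  by apply: (IHn y Py); apply: leq_trans lt_yx _.
exists x; split=> // y Py; rewrite leqNgt; apply/negP => lt_yx.
by apply: noy; exists y.
Qed.

Lemma ex_max_set (T : finType) (P : {set T} -> Prop) (A : {set T}) :
  P A -> exists B : {set T},
    [/\ A \subset B, P B & forall C : {set T}, P C -> B \subset C -> C = B].
Proof.
move=> PA.
have [B [[PB sAB] minB]] := @ex_min_measure {set T} (fun B : {set T} => P B /\ A \subset B)
  (fun B : {set T} => #|~: B|) (ex_intro _ A (conj PA (subxx A))).
exists B; split=> // C PC sBC; apply/eqP; rewrite eq_sym eqEcard sBC /=.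
have := minB C (conj PC (subset_trans sAB sBC)).
by rewrite -(leq_add2l #|B|) cardsC -(cardsC C) leq_add2r.
Qed.

(** Points moved by [f] come in pairs [x, f x]; the induction removes one such pair from [C] at a
    time. *)
Lemma odd_card_involution (T : finType) (f : T -> T) (C : {set T}) :
  involutive f -> {in C, forall x, f x \in C} ->
  odd #|C| = odd #|[set x in C | f x == x]|.
Proof.
move=> fK; have [n] := ubnP #|C|; elim: n => // n IHn in C *; move=> ltCn fC.
have [fixC|] := boolP [forall x in C, f x == x].
  congr (odd _); apply: eq_card => x; rewrite inE.
  by case xC: (x \in C) => //=; rewrite (forall_inP fixC _ xC).
rewrite negb_forall_in => /exists_inP[x xC fxx].
pose C' := C :\: [set x; f x].
have cC : #|C| = #|C'|.+2.
  rewrite -(cardsID [set x; f x] C) -/C'.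
  have /setIidPr -> : [set x; f x] \subset C by rewrite subUset !sub1set xC fC.
  by rewrite cards2 eq_sym fxx.
rewrite cC /= negbK IHn.
- congr (odd _); apply: eq_card => y; rewrite /C' !inE.
  case: (eqVneq y x) => [->|yx]; first by rewrite (negPf fxx) !andbF.
  by case: (eqVneq y (f x)) => [->|//]; rewrite fK eq_sym (negPf fxx) !andbF.
- by move: ltCn; rewrite cC !ltnS; apply: leq_trans.
move=> y; rewrite /C' !inE !negb_or => /andP[/andP[yx yfx] yC]; rewrite fC // andbT.
by rewrite (can_eq fK) yx (can2_eq fK fK) yfx.
Qed.

(** * Maximum matchings *)

Section Matching.
Variables (V : finType) (r : rel V).
Hypothesis r_sym : symmetric r.
Implicit Types (Y X C : {set V}) (f : V -> V).

(** The involution swaps matched vertices and fixes unmatched ones. The partner of a moved vertex is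
    moved too, so both ends of a matching edge lie in [Y]. *)
Definition matching Y f : Prop :=
  involutive f /\ forall x, f x != x -> (x \in Y) && r x (f x).

Definition exposed Y f : {set V} := [set x in Y | f x == x].

Definition max_matching Y f : Prop :=
  matching Y f /\ forall f', matching Y f' -> #|exposed Y f| <= #|exposed Y f'|.

Lemma max_matching_exists Y : exists f, max_matching Y f.
Proof.
apply: (@ex_min_measure _ (matching Y) (fun f => #|exposed Y f|)).
by exists id; split=> // x; rewrite eqxx.
Qed.

Lemma matching_stable Y f x : matching Y f -> x \in Y -> f x \in Y.
Proof.
case=> fK mf xY; have [->//|fxx] := eqVneq (f x) x.
by have := mf (f x); rewrite fK eq_sym => /(_ fxx) /andP[].
Qed.

Lemma odd_exposed Y f : matching Y f -> odd #|exposed Y f| = odd #|Y|.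
Proof.
by move=> mf; rewrite [RHS](odd_card_involution mf.1) // => x; apply: matching_stable.
Qed.

(** Meant for an exposed [x]: the edge [x y] replaces the matching edge at [y], and exposure passes
    from [x] to [f y]. If [y] was exposed as well, the matching gains an edge. *)
Definition rematch f x y : V -> V := fun w =>
  if w == x then y else if w == y then x else if w == f y then w else f w.

Lemma rematch_matching Y f x y : matching Y f -> x \in exposed Y f -> y \in Y ->
  x != y -> r x y -> matching Y (rematch f x y).
Proof.
move=> [fK mf]; rewrite inE => /andP[xY /eqP fx] yY xy rxy.
split=> [w|w]; rewrite /rematch.
  case: (eqVneq w x) => [->|wx]; first by rewrite eqxx eq_sym (negPf xy).
  case: (eqVneq w y) => [->|wy]; first by rewrite eqxx.
  case: (eqVneq w (f y)) => [wfy|wfy].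
    by rewrite (negPf wx) (negPf wy) wfy eqxx.
  rewrite (can_eq fK) (negPf wy) (can2_eq fK fK) fx (negPf wx).
  by rewrite (can2_eq fK fK) (negPf wfy) fK.
case: (eqVneq w x) => [->|wx]; first by rewrite xY.
case: (eqVneq w y) => [->|wy]; first by rewrite yY r_sym.
by case: (eqVneq w (f y)) => [->|wfy]; [rewrite eqxx | exact: mf].
Qed.

Lemma exposed_rematch Y f x y : matching Y f -> x \in exposed Y f -> y \in Y ->
  x != y -> exposed Y (rematch f x y) =
            if f y == y then exposed Y f :\ x :\ y else f y |: (exposed Y f :\ x).
Proof.
move=> mf xE yY xy; have fyY := matching_stable mf yY.
have [fK _] := mf; move: (xE); rewrite inE => /andP[xY /eqP fx].
have fyx : f y != x by rewrite (can2_eq fK fK) fx eq_sym.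
apply/setP=> w; rewrite inE /rematch.
case fy: (f y == y); rewrite !inE.
  rewrite (eqP fy); case: (eqVneq w x) => [->|wx].
    by rewrite [y == x]eq_sym (negPf xy) !andbF.
  by case: (eqVneq w y) => [->|wy]; rewrite ?(negPf xy) ?andbF.
case: (eqVneq w x) => [->|wx].
  by rewrite [y == x]eq_sym (negPf xy) [x == _]eq_sym (negPf fyx) !andbF.
case: (eqVneq w y) => [->|wy].
  by rewrite (negPf xy) [y == _]eq_sym fy andbF andbF.
by case: (eqVneq w (f y)) => [->|wfy]; rewrite ?eqxx ?fyY.
Qed.

Lemma max_matching_adj Y f x y : max_matching Y f -> x \in exposed Y f ->
  y \in exposed Y f -> x != y -> ~~ r x y.
Proof.
move=> [mf maxf] xE yE xy; apply/negP => rxy.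
have [yY fy] : y \in Y /\ f y == y by apply/andP; rewrite inE in yE.
have := maxf _ (rematch_matching mf xE yY xy rxy).
rewrite (exposed_rematch mf xE yY xy) fy.
rewrite leqNgt => /negP; apply; rewrite [#|exposed Y f|](cardsD1 x) xE.
by rewrite (cardsD1 y (_ :\ x)) !inE eq_sym xy fy yY /= ltnS leqnSn.
Qed.

Lemma max_matching_card Y f f' :
  max_matching Y f -> max_matching Y f' -> #|exposed Y f| = #|exposed Y f'|.
Proof.
by move=> [mf maxf] [mf' maxf']; apply/eqP; rewrite eqn_leq maxf ?maxf'.
Qed.

(** Gallai's relation: it is transitive through vertices exposed by some maximum matching, and its
    classes become the odd parts of the partition. *)
Definition never_both Y u v : Prop :=
  u = v \/ forall f, max_matching Y f -> u \in exposed Y f -> v \notin exposed Y f.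

(* Among the maximum matchings exposing the middle vertex take the one agreeing
   most with [M]; switching it along an edge of [M] would increase the agreement. *)
Lemma never_both_trans Y u t v :
  (exists2 f, max_matching Y f & t \in exposed Y f) ->
  never_both Y u t -> never_both Y t v -> never_both Y u v.
Proof.
move=> [f0 max0 t0] [<-//|ut] [<-|tv]; first by right.
have [->|uv] := eqVneq u v; first by left.
right=> M maxM uM; apply/negP => vM.
have [N [[maxN tN] bestN]] := @ex_min_measure _
  (fun N => max_matching Y N /\ t \in exposed Y N)
  (fun N => #|[set w | M w != N w]|) (ex_intro _ f0 (conj max0 t0)).
have uN : u \notin exposed Y N by apply/negP => /(ut _ maxN); rewrite tN.
have vN : v \notin exposed Y N by apply: tv tN.
have tM : t \notin exposed Y M by apply: ut uM.
(* Maximum matchings expose equally many vertices. [M] exposes [u] and [v], which [N] covers, so [N]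
   exposes at least two vertices covered by [M], one of them different from [t]. *)
have [x [xN xM xt]] : exists x, [/\ x \in exposed Y N, x \notin exposed Y M & x != t].
  have cD : #|exposed Y N :\: exposed Y M| = #|exposed Y M :\: exposed Y N|.
    apply/eqP; rewrite -(eqn_add2l #|exposed Y N :&: exposed Y M|) cardsID.
    by rewrite setIC cardsID (max_matching_card maxM maxN).
  have : 1 < #|exposed Y N :\: exposed Y M|.
    rewrite cD; have <- : #|[set u; v]| = 2 by rewrite cards2 uv.
    by apply: subset_leq_card; rewrite subUset !sub1set !in_setD uN vN uM vM.
  rewrite (cardsD1 t) in_setD tN tM /= ltnS card_gt0 => /set0Pn[x].
  by rewrite !in_setD in_set1 => /and3P[xt xM xN]; exists x; split.
have [mM _] := maxM; have [mN minN] := maxN.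
have [xY Nx] : x \in Y /\ N x = x by move: xN; rewrite inE => /andP[? /eqP].
have [yY yx rxy] : [/\ M x \in Y, M x != x & r x (M x)].
  have Mxx : M x != x by move: xM; rewrite inE xY.
  by have /andP[_ ->] := mM.2 _ Mxx; split=> //; apply: matching_stable.
set y := M x in yY yx rxy; have xy : x != y by rewrite eq_sym.
have yN : y \notin exposed Y N.
  by apply/negP => yN; have := max_matching_adj maxN xN yN xy; rewrite rxy.
have Nyy : N y == y = false by apply/negbTE; move: yN; rewrite inE yY.
have mN' := rematch_matching mN xN yY xy rxy.
have eN' := exposed_rematch mN xN yY xy; rewrite Nyy in eN'.
have cN' : #|exposed Y (rematch N x y)| <= #|exposed Y N|.
  by rewrite eN' (cardsD1 x (exposed Y N)) xN cardsU1 leq_add2r leq_b1.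
have maxN' : max_matching Y (rematch N x y).
  by split=> // f' mf'; apply: leq_trans cN' (minN _ mf').
have tN' : t \in exposed Y (rematch N x y).
  by rewrite eN' in_setU1 in_setD1 tN andbT [t == x]eq_sym xt orbT.
have := bestN _ (conj maxN' tN'); rewrite leqNgt => /negP; apply.
apply: proper_card; apply/properP; split.
  apply/subsetP => w; rewrite !inE /rematch.
  case: (eqVneq w x) => [->|wx]; first by rewrite eqxx.
  case: (eqVneq w y) => [->|wy]; first by rewrite mM.1 eqxx.
  case: (eqVneq w (N y)) => [->|//] _; rewrite mN.1 (can2_eq mM.1 mM.1) mM.1.
  by rewrite (can2_eq mN.1 mN.1) Nx eq_sym.
by exists x; rewrite inE ?Nx // /rematch eqxx /= -/y eqxx.
Qed.

(* Gallai's lemma: take [X] maximal such that every matching of [Y :\: X] leaves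
   [#|X|] more vertices exposed than the maximum matchings of [Y]; then every
   vertex of [Y :\: X] is exposed by some maximum matching of [Y :\: X]. *)
Theorem gallai_partition Y : exists f X (P : {set {set V}}),
  [/\ matching Y f /\ X \subset Y, partition P (Y :\: X),
      #|exposed Y f| + #|X| <= #|P|,
      (forall C, C \in P -> odd #|C|)
    & (forall C x y, C \in P -> x \in C -> y \in Y :\: X -> r x y -> y \in C)].
Proof.
have [f maxf] := max_matching_exists Y.
pose good X := X \subset Y /\ forall f', matching (Y :\: X) f' ->
  #|exposed Y f| + #|X| <= #|exposed (Y :\: X) f'|.
have good0 : good set0.
  by split=> [|f']; rewrite ?sub0set // setD0 cards0 addn0; apply: maxf.2.
have [X [_ [sXY defX] maxX]] := ex_max_set good0.
have [Z defZ] : exists Z, Z = Y :\: X by exists (Y :\: X).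
rewrite -defZ in defX *.
have inessential v : v \in Z -> exists2 f', max_matching Z f' & v \in exposed Z f'.
  move=> vZ; apply: NNPP => ess.
  have [vY vX] : v \in Y /\ v \notin X by apply/setDP; rewrite -defZ.
  suff /maxX/(_ (subsetUr _ _))/setP/(_ v) : good (v |: X).
    by rewrite !inE eqxx (negPf vX).
  split; first by rewrite subUset sXY sub1set vY.
  move=> f'; have -> : Y :\: (v |: X) = Z :\ v by rewrite defZ setDDl setUC.
  move=> mf'; have f'v : f' v = v.
    by apply/eqP/negPn/negP => /mf'.2; rewrite !inE eqxx.
  have mf'Z : matching Z f'.
    split; [exact: mf'.1 | move=> x /mf'.2/andP[+ ->]].
    by rewrite in_setD1 => /andP[_ ->].
  have eE : exposed Z f' = v |: exposed (Z :\ v) f'.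
    apply/setP => x; rewrite in_setU1 ![_ \in exposed _ _]in_set in_setD1.
    by case: (eqVneq x v) => [->|//]; rewrite vZ f'v eqxx.
  have cE : #|exposed Z f'| = #|exposed (Z :\ v) f'|.+1.
    by rewrite eE cardsU1 !inE eqxx.
  have [g maxg] := max_matching_exists Z.
  have lt_g : #|exposed Z g| < #|exposed Z f'|.
    rewrite ltn_neqAle maxg.2 // andbT; apply/negP => /eqP eq_g.
    apply: ess; exists f'; last by rewrite inE vZ f'v eqxx.
    by split=> // h /maxg.2; rewrite eq_g.
  (* Both counts have the parity of [#|Z|], so they differ by at least two; this pays for the
     exposed [v] and for the enlarged [X]. *)
  have odd_g : odd #|exposed Z g| = odd #|exposed Z f'|.
    by rewrite (odd_exposed maxg.1) (odd_exposed mf'Z).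
  rewrite cardsU1 vX addnCA add1n; apply: leq_ltn_trans (defX _ maxg.1) _.
  move: lt_g odd_g; rewrite cE ltnS leq_eqVlt => /orP[/eqP->|//] /=.
  by case: (odd _).
have [g maxg] := max_matching_exists Z.
have [R RP] : exists R : V * V -> bool, forall uv, R uv <-> never_both Z uv.1 uv.2.
  apply: (fin_all_exists (P := fun uv b => is_true b <-> never_both Z uv.1 uv.2)).
  move=> uv; case: (classic (never_both Z uv.1 uv.2)) => h; first by exists true.
  by exists false; split.
have Rsym u v : R (u, v) -> R (v, u).
  move=> /RP /= [->|uv]; apply/RP; [by left | right=> h maxh vh /=].
  by apply/negP => /(uv h maxh); rewrite vh.
have Rtrans t u v : t \in Z -> R (u, t) -> R (t, v) -> R (u, v).
  by move=> /inessential ht /RP/= ut /RP/= tv; apply/RP/(never_both_trans ht ut tv).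
have eqR : {in Z & &, equivalence_rel (fun u v => R (u, v))}.
  move=> u v w uZ vZ wZ; split=> [|uv]; first by apply/RP; left.
  by apply/idP/idP => [|vw]; [apply: Rtrans (Rsym _ _ uv) | apply: Rtrans uv vw].
have Radj u v : r u v -> R (u, v).
  move=> ruv; apply/RP; have [->|uv] := eqVneq u v; [by left | right=> h maxh uh /=].
  by apply/negP => vh; have := max_matching_adj maxh uh vh uv; rewrite ruv.
exists f, X, (equivalence_partition (fun u v => R (u, v)) Z).
have classZ C u : C \in equivalence_partition (fun u v => R (u, v)) Z ->
    u \in C -> u \in Z /\ C = [set v in Z | R (u, v)].
  case/imsetP => w wZ ->; rewrite inE => /andP[uZ wu]; split=> //.
  apply/setP => v; rewrite !inE; apply: andb_id2l => vZ.
  by have [_ ->] := eqR w u v wZ uZ vZ.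
rewrite -defZ; split; first by split=> //; apply: maxf.1.
- exact: equivalence_partitionP.
- apply: leq_trans (defX _ maxg.1) _.
  (* Two vertices exposed by the same maximum matching lie in different classes, so there are at
     least as many classes as exposed vertices. *)
  have inj_class : {in exposed Z g &, injective (fun u => [set v in Z | R (u, v)])}.
    move=> u v ug vg /setP/(_ v); have vZ : v \in Z by move: vg; rewrite inE => /andP[].
    rewrite !inE vZ /=; have -> : R (v, v) by apply/RP; left.
    move/RP => /= [//|/(_ g maxg ug)]; by rewrite vg.
  rewrite -(card_in_imset inj_class); apply/subset_leq_card/subsetP => _ /imsetP[u ug ->].
  by apply/imsetP; exists u => //; move: ug; rewrite inE => /andP[].
- move=> C CP; have [v vZ defC] := imsetP CP.
  have [h maxh vh] := inessential v vZ.
  have vv : R (v, v) by apply/RP; left.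
  (* Matched vertices are adjacent, hence equivalent, so [h] preserves the class of [v]. Its only
     fixed point there is [v], since no equivalent vertex is exposed together with [v]. *)
  have hC x : x \in C -> h x \in C.
    move=> xC; have [xZ ->] := classZ C x CP xC.
    rewrite inE (matching_stable maxh.1 xZ).
    have [->|hx] := eqVneq (h x) x; first by apply/RP; left.
    by apply: Radj; have /andP[] := maxh.1.2 _ hx.
  rewrite (odd_card_involution maxh.1.1) //.
  suff -> : [set x in C | h x == x] = [set v] by rewrite cards1.
  apply/setP => x; rewrite !inE; apply/andP/eqP => [[xC hx]|->]; last first.
    by split; [rewrite defC inE vZ | move: vh; rewrite inE vZ].
  have [xZ vx] : x \in Z /\ R (v, x) by apply/andP; move: xC; rewrite defC inE.
  by move/RP: vx => /= [//|/(_ h maxh vh)]; rewrite inE xZ hx.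
move=> C x y CP xC yZ rxy; have [xZ ->] := classZ C x CP xC.
by rewrite inE yZ; apply: Radj.
Qed.
End Matching.

(** * Duality for breaking paths *)

Section ReturningIterates.
Variables (V : finType) (f g : V -> V).
Hypotheses (fK : involutive f) (gK : involutive g).
Let h := g \o f.

Lemma comp_involutions_inj : injective h.
Proof. by apply: inj_comp; apply: inv_inj. Qed.

Lemma iter_comp_inj i : injective (iter i h).
Proof. by elim: i => // i IHi x y /comp_involutions_inj /IHi. Qed.

Lemma iter_order_lt2 x l : iter l h x = x -> l < (order h x).*2 ->
  l = 0 \/ l = order h x.
Proof.
move=> lx ltl; have [lt_n|ge_n] := ltnP l (order h x).
  by left; rewrite -(findex_iter lt_n) lx findex0.
right; have lt_n : l - order h x < order h x by rewrite ltn_subLR // addnn.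
have : iter (l - order h x) h x = x.
  by rewrite -[X in iter _ _ X = _](iter_order comp_involutions_inj x) -iterD subnK.
move=> /(congr1 (findex h x)); rewrite findex_iter // findex0 => /eqP.
by rewrite subn_eq0 => le_n; apply/eqP; rewrite eqn_leq le_n.
Qed.

(** The involution [g] conjugates [h] to its inverse, so from a fixed point of [g] it sends the
    [i]-th forward iterate to the [i]-th backward one. *)
Lemma iter_reflect i x : g x = x -> iter i h (g (iter i h x)) = x.
Proof.
move=> gx; elim: i => //= i IHi.
by rewrite -iterS iterSr /h /= gK fK.
Qed.

Lemma iter_reflect_f i x : g x = x -> iter i.+1 h (f (iter i h x)) = x.
Proof. by move=> gx; rewrite iterSr /h /= fK iter_reflect. Qed.

Lemma iter_fix_g i x : g x = x -> g (iter i h x) = iter i h x ->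
  iter i.*2 h x = x.
Proof. by move=> gx gi; rewrite -addnn iterD -[X in iter _ _ X = _]gi iter_reflect. Qed.

(** For order [2m], the [m]-th iterate and its image under [g] are both sent to [x] by [m] further
    iterations, and iterates of [h] are injective. *)
Lemma iter_half_even x : g x = x -> ~~ odd (order h x) ->
  g (iter (order h x)./2 h x) = iter (order h x)./2 h x.
Proof.
move=> gx ev; apply: (@iter_comp_inj (order h x)./2).
by rewrite iter_reflect // -iterD addnn even_halfK // (iter_order comp_involutions_inj).
Qed.

Lemma iter_half_odd x : g x = x -> odd (order h x) ->
  f (iter (order h x)./2 h x) = iter (order h x)./2 h x.
Proof.
move=> gx od; apply: (@iter_comp_inj (order h x)./2.+1).
rewrite iter_reflect_f // -iterD addSn addnn -add1n.
have := odd_double_half (order h x); rewrite od => ->.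
by rewrite (iter_order comp_involutions_inj).
Qed.

Lemma order_iter i x : order h (iter i h x) = order h x.
Proof.
apply: eq_card => y; apply: (same_connect (fconnect_sym comp_involutions_inj)).
by rewrite fconnect_sym ?fconnect_iter //; apply: comp_involutions_inj.
Qed.

Lemma fconnect_g i x : g x = x -> fconnect h x (g (iter i h x)).
Proof.
move=> gx; rewrite fconnect_sym; last exact: comp_involutions_inj.
by have := fconnect_iter h i (g (iter i h x)); rewrite iter_reflect.
Qed.

(** If [y] is reached after [l] steps, then [2l] steps return to [x]; as [2l] is less than twice the
    order, it is zero or the order itself. An orbit thus has at most two fixed points of [g]. *)
Lemma fconnect_fix_g x y : g x = x -> g y = y -> fconnect h x y ->
  y = x \/ ~~ odd (order h x) /\ y = iter (order h x)./2 h x.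
Proof.
move=> gx gy xy; have lt_n := findex_max xy; have defy := iter_findex xy.
have := iter_fix_g (i := findex h x y) gx; rewrite defy => /(_ gy) l2.
case: (iter_order_lt2 l2) => [|/eqP|eq_n]; first by rewrite ltn_double.
  by rewrite double_eq0 findex_eq0 => /eqP->; left.
by right; rewrite -eq_n odd_double doubleK defy.
Qed.
End ReturningIterates.

(** * Breaking paths as alternating paths in the doubled graph *)

Section OddPaths.
Variables (T : finType) (e : rel T) (c : T -> bool) (A : {set T}).
Hypothesis e_sym : symmetric e.

(** A path properly coloured by [c] has [odd (size s) = (c x != c (last x s))], [size s] being its
    number of edges. The reversed parity also excludes one-vertex paths. *)
Definition breaking_path (x : T) (s : seq T) : Prop :=
  [/\ path e x s, uniq (x :: s), (x \in A) && (last x s \in A),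
      {in x :: s, forall v, v \in A -> v = x \/ v = last x s}
    & odd (size s) = (c x == c (last x s))].

Definition disjoint_breaking_paths k : Prop :=
  exists p : 'I_k -> T * seq T,
    (forall j, breaking_path (p j).1 (p j).2) /\
    (forall i j v, v \in (p i).1 :: (p i).2 -> v \in (p j).1 :: (p j).2 -> i = j).

(* Two copies of the graph, except that a vertex [a] of [A] keeps only the copy
   [c a]; the two copies of a vertex outside [A] are joined by an edge. A lift of
   a path changes copy after each edge, so that it joins the copies of two vertices
   of [A] exactly when the path is breaking. *)
Definition dvert : {set T * bool} :=
  [set x | (x.1 \in A) ==> (x.2 == c x.1)].

Definition dadj : rel (T * bool) := fun x y =>
  ((x.2 == y.2) && e x.1 y.1) || ((x.1 == y.1) && (x.2 != y.2)).

(** The matching made of the links; within [dvert] it exposes exactly the copies of vertices of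
    [A]. *)
Definition mate (x : T * bool) : T * bool :=
  if x.1 \in A then x else (x.1, ~~ x.2).

Definition copy (a : T) : T * bool := (a, c a).

Lemma dadj_sym : symmetric dadj.
Proof. by move=> x y; rewrite /dadj e_sym ![_.1 == y.1]eq_sym ![_.2 == y.2]eq_sym. Qed.

Lemma mateK : involutive mate.
Proof.
by case=> v b; rewrite /mate /=; case vA: (v \in A); rewrite /= vA // negbK.
Qed.

Lemma mate1 x : (mate x).1 = x.1.
Proof. by rewrite /mate; case: ifP. Qed.

Lemma mate2 x : (mate x).2 = if x.1 \in A then x.2 else ~~ x.2.
Proof. by rewrite /mate; case: ifP. Qed.

Lemma mate_dvert x : x \in dvert -> mate x \in dvert.
Proof. by rewrite !inE mate1 /mate; case: ifP. Qed.

Lemma mate_fix x : (mate x == x) = (x.1 \in A).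
Proof.
case: x => v b; rewrite /mate /=; case: (v \in A); first exact: eqxx.
by rewrite xpair_eqE eqxx; case: b.
Qed.

Lemma mate_copy a : a \in A -> mate (copy a) = copy a.
Proof. by rewrite /mate /= => ->. Qed.

Lemma copy_dvert a : copy a \in dvert.
Proof. by rewrite inE /= eqxx implybT. Qed.

Lemma dvert_eq1 x y : x \in dvert -> y \in dvert -> x.1 = y.1 -> y = x \/ y = mate x.
Proof.
case: x y => v b [w b']; rewrite !inE /mate /= => vb wb' eq_vw; subst w.
case: (v \in A) vb wb' => /=; first by move=> /eqP-> /eqP->; left.
by case: b b' => [] [] _ _; [left|right|right|left].
Qed.

Variable f : T * bool -> T * bool.
Hypothesis mf : matching dadj dvert f.
Let h := mate \o f.
Let fK : involutive f := mf.1.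

Lemma iter_dvert i x : x \in dvert -> iter i h x \in dvert.
Proof.
by move=> xD; elim: i => //= i IHi; apply: mate_dvert (matching_stable mf IHi).
Qed.

(** One application of [h] follows an edge of [f] and then a link. From [copy a] the orbit runs to
    the far end of its alternating path and back, so half of its order is the length of the
    projected path. *)
Definition alternating_path (a : T) : T * seq T :=
  (a, [seq (iter i h (copy a)).1 | i <- iota 1 (order h (copy a))./2]).

Section Alternating.
Variables (a : T).
Hypotheses (aA : a \in A) (ev : ~~ odd (order h (copy a))).
Let m := (order h (copy a))./2.
Let x_ i := iter i h (copy a).
Let order2 : order h (copy a) = m.*2.
Proof. by rewrite even_halfK. Qed.
Let m_gt0 : 0 < m.
Proof. by have := order_gt0 h (copy a); rewrite order2 double_gt0. Qed.
Let fixa : mate (copy a) = copy a := mate_copy aA.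

(** Iterates over the same vertex are equal or mates. If they are mates, reflection shows that
    [i + j] steps return to [copy a], so [i + j] is [0] or [2m], which forces [i = j]. *)
Lemma alternating_inj i j : i <= m -> j <= m -> (x_ i).1 = (x_ j).1 -> i = j.
Proof.
move=> le_im le_jm /(dvert_eq1 (iter_dvert _ (copy_dvert a)) (iter_dvert _ (copy_dvert a))).
have lt_l l : l <= m -> l < order h (copy a) by rewrite order2; lia.
case=> eq_ji.
  by rewrite -(findex_iter (lt_l _ le_im)) -eq_ji findex_iter ?lt_l.
have : iter (i + j) h (copy a) = copy a.
  by rewrite iterD eq_ji iter_reflect //; apply: mateK.
move/(iter_order_lt2 fK mateK); rewrite order2 => /(_ _)[|ij0|ijm].
- by lia.
- by lia.
by lia.
Qed.

Lemma alternating_A i : i <= m -> (x_ i).1 \in A -> i = 0 \/ i = m.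
Proof.
rewrite -mate_fix => le_im /eqP gi.
have := iter_fix_g fK mateK fixa gi => /(iter_order_lt2 fK mateK).
rewrite order2 ltn_double => /(_ _)[|/eqP|/double_inj]; last by right.
  by lia.
by rewrite double_eq0 => /eqP; left.
Qed.

Lemma alternating_last : x_ m = copy (x_ m).1 /\ (x_ m).1 \in A.
Proof.
have := iter_half_even fK mateK fixa ev; rewrite -/m -/(x_ m) => /eqP.
rewrite mate_fix => mA; split=> //; have := iter_dvert m (copy_dvert a).
by rewrite -/(x_ m) inE mA /= /copy => /eqP <-; case: (x_ m).
Qed.

(** If [f] fixed the iterate, an odd number of steps would return to [copy a], against the even
    order; if [f] followed a link, [h] would fix the iterate. *)
Lemma alternating_edge i : i < m ->
  e (x_ i).1 (x_ i.+1).1 /\ (f (x_ i)).2 = (x_ i).2.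
Proof.
move=> lt_im; have ffix : f (x_ i) != x_ i.
  apply/eqP => fi; have := iter_reflect_f fK mateK i fixa; rewrite fi -iterD.
  by move/(iter_order_lt2 fK mateK); rewrite order2; lia.
have /andP[_ /orP[/andP[/eqP <- eif]|/andP[/eqP e1 n2]]] := mf.2 _ ffix.
  by rewrite /x_ /= mate1.
have fD : f (x_ i) \in dvert by apply: (matching_stable mf); exact: iter_dvert (copy_dvert a).
case: (dvert_eq1 (iter_dvert i (copy_dvert a)) fD e1) => fi.
  by rewrite fi eqxx in ffix.
have hx : h (x_ i) = x_ i := etrans (congr1 mate fi) (mateK _).
have : i = i.+1 by apply: alternating_inj; [exact: ltnW | | exact: esym (congr1 fst hx)].
by lia.
Qed.

Lemma alternating_breaking : breaking_path (alternating_path a).1 (alternating_path a).2.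
Proof.
rewrite /alternating_path /= -/m -/x_.
have nthx v i : i <= m -> nth v (a :: [seq (x_ i).1 | i <- iota 1 m]) i = (x_ i).1.
  by case: i => // i lt_im /=; rewrite (nth_map 0) ?size_iota // nth_iota.
have lastx : last a [seq (x_ i).1 | i <- iota 1 m] = (x_ m).1.
  by rewrite -(nthx a m) // (last_nth a) size_map size_iota.
have [copym mA] := alternating_last.
have sz : size [seq (x_ i).1 | i <- iota 1 m] = m by rewrite size_map size_iota.
split; rewrite ?lastx ?aA ?mA //.
- apply/(pathP a) => i; rewrite sz => lt_im.
  have := nthx a i.+1 lt_im; rewrite (nthx a i (ltnW lt_im)) [nth _ _ i.+1]/= => ->.
  by have [] := alternating_edge lt_im.
- apply/(uniqP a) => i j; rewrite !inE /= sz !ltnS => le_im le_jm.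
  by rewrite !nthx //; apply: alternating_inj.
- move=> v /(nthP a)[i]; rewrite /= sz ltnS => le_im <-; rewrite nthx // => vA.
  by case: (alternating_A le_im vA) => ->; [left | right].
have xS i : x_ i.+1 = mate (f (x_ i)) by [].
(* Every link before the last vertex changes the copy. The last vertex lies in [A], where [mate]
   does nothing; this shift by one is what makes the path breaking. *)
have side i : i < m -> (x_ i).2 = c a (+) odd i.
  elim: i => [_|i IHi lt_im]; first by rewrite addbF.
  have [_ fi] := alternating_edge (ltnW lt_im).
  have nA : (x_ i.+1).1 \notin A.
    by apply/negP => /(alternating_A (ltnW lt_im)); lia.
  rewrite xS mate1 in nA; rewrite xS mate2 (negPf nA) fi IHi ?(ltnW lt_im) //=.
  by rewrite addbN.
have [m' defm] : exists m', m = m'.+1 by exists m.-1; rewrite prednK.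
have lt_m' : m' < m by rewrite defm.
have [_ fi] := alternating_edge lt_m'.
have cm : c (x_ m).1 = c a (+) odd m'.
  rewrite -(side _ lt_m') -fi; have -> : c (x_ m).1 = (x_ m).2 by rewrite [in RHS]copym.
  by move: mA; rewrite defm xS mate1 mate2 => ->.
by rewrite sz cm defm /=; case: (c a); case: (odd m').
Qed.
End Alternating.

(** Even order means that the alternating path from [a] ends in [A] again, at [antipode a], and not
    at a vertex exposed by [f]. *)
Definition balanced : {set T} := [set a in A | ~~ odd (order h (copy a))].
Definition antipode (a : T) : T := (iter (order h (copy a))./2 h (copy a)).1.

Lemma antipodeP a : a \in balanced ->
  [/\ copy (antipode a) = iter (order h (copy a))./2 h (copy a),
      antipode a \in balanced & antipode (antipode a) = a].
Proof.
rewrite inE => /andP[aA ev]; have [ce aA'] := alternating_last aA ev.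
have oe : order h (copy (antipode a)) = order h (copy a).
  by rewrite /antipode -ce order_iter //; apply: mateK.
split; first by rewrite [RHS]ce.
  by rewrite inE aA' oe.
rewrite [LHS]/antipode oe (esym ce : copy (antipode a) = _) -iterD addnn even_halfK //.
by rewrite iter_order //; apply: comp_involutions_inj fK mateK.
Qed.

Lemma antipode_neq a : a \in balanced -> antipode a != a.
Proof.
rewrite inE => /andP[aA ev]; apply/eqP => eqa.
have : 0 = (order h (copy a))./2 by apply: (alternating_inj aA ev) => //; rewrite -[RHS]eqa.
by have := order_gt0 h (copy a); lia.
Qed.

(** A common vertex puts [copy a] and [copy b] into one orbit, which has at most two points fixed by
    [mate]. *)
Lemma alternating_meet a b v : a \in balanced -> b \in balanced ->
  v \in (alternating_path a).1 :: (alternating_path a).2 ->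
  v \in (alternating_path b).1 :: (alternating_path b).2 ->
  b = a \/ b = antipode a.
Proof.
move=> aB bB; have memE d :
    v \in (alternating_path d).1 :: (alternating_path d).2 ->
    exists i, v = (iter i h (copy d)).1.
  rewrite /alternating_path /= inE => /orP[/eqP->|/mapP[i _ ->]].
    by exists 0.
  by exists i.
move=> /memE[i vi] /memE[j]; rewrite vi.
have [[aA aev] [bA bev]] : (a \in A /\ ~~ odd (order h (copy a))) /\
   (b \in A /\ ~~ odd (order h (copy b))).
  by move: aB bB; rewrite !inE => /andP[] ? ? /andP[].
have hinj := comp_involutions_inj fK mateK.
move=> /(dvert_eq1 (iter_dvert _ (copy_dvert a)) (iter_dvert _ (copy_dvert b))) ij.
have : fconnect h (copy a) (copy b).
  apply: (@connect_trans _ _ (iter j h (copy b))); last first.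
    by rewrite fconnect_sym // fconnect_iter.
  case: ij => ->; first exact: fconnect_iter.
  by apply: fconnect_g fK mateK _ _ (mate_copy aA).
case/(fconnect_fix_g fK mateK (mate_copy aA) (mate_copy bA)) => [[->]|[_ eb]].
  by left.
by right; rewrite /antipode -/h -eb.
Qed.

(** When the order is odd, the middle of the orbit is exposed by [f], and it determines the starting
    point since only an orbit of even order contains a second copy from [A] that [mate] fixes. *)
Lemma balanced_card : #|A| <= #|balanced| + #|exposed dvert f|.
Proof.
rewrite -(cardsID balanced A); apply: leq_add; first exact: subset_leq_card (subsetIr _ _).
pose mid a := iter (order h (copy a))./2 h (copy a).
have hinj := comp_involutions_inj fK mateK.
have oddD a : a \in A :\: balanced -> a \in A /\ odd (order h (copy a)).
  by rewrite !inE => /andP[+ aA]; rewrite aA negbK.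
rewrite -(card_in_imset (f := mid)).
  apply/subset_leq_card/subsetP => _ /imsetP[a /oddD[aA od] ->].
  rewrite [_ \in exposed _ _]inE iter_dvert ?copy_dvert //=; apply/eqP.
  exact: (iter_half_odd fK mateK (mate_copy aA)).
move=> a b /oddD[aA aod] /oddD[bA bod] eq_mid.
have : fconnect h (copy a) (copy b).
  apply: (@connect_trans _ _ (mid b)); first by rewrite -eq_mid; exact: fconnect_iter.
  by rewrite fconnect_sym //; exact: fconnect_iter.
case/(fconnect_fix_g fK mateK (mate_copy aA) (mate_copy bA)) => [[->]//|[]].
by rewrite aod.
Qed.

Lemma exposed_breaking_paths k :
  #|exposed dvert f| + 2 * k <= #|A|.+1 -> disjoint_breaking_paths k.
Proof.
(* Antipodal vertices start the same path, so [D] keeps one of each pair, the one of smaller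
   rank. *)
move=> le_k; pose D := [set a in balanced | enum_rank a < enum_rank (antipode a)].
have le_B : #|balanced| <= 2 * #|D|.
  have /subset_leq_card : balanced \subset D :|: antipode @: D.
    apply/subsetP => a aB; rewrite inE; have [ltr|] := boolP (a \in D) => //=.
    have [_ a'B aK] := antipodeP aB.
    rewrite inE aB -leqNgt leq_eqVlt => /orP[/eqP/ord_inj/enum_rank_inj eq_a|lt_a].
      by have := antipode_neq aB; rewrite eq_a eqxx.
    by apply/imsetP; exists (antipode a); rewrite // inE a'B aK.
  move/leq_trans; apply; apply: leq_trans (leq_card_setU _ _) _.
  by rewrite mul2n -addnn leq_add2l leq_imset_card.
have le_kD : k <= #|D| by have := balanced_card; lia.
pose p (j : 'I_k) := enum_val (widen_ord le_kD j).
have pD j : p j \in balanced /\ enum_rank (p j) < enum_rank (antipode (p j)).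
  by apply/andP; have := enum_valP (widen_ord le_kD j); rewrite inE.
exists (fun j => alternating_path (p j)); split=> [j|i j v vi vj].
  by have [] := pD j; rewrite inE => /andP[? ?] _; apply: alternating_breaking.
have [iB ri] := pD i; have [jB rj] := pD j.
suff : p i = p j.
  by move/enum_val_inj/(congr1 val) => /= ij; apply: val_inj.
case: (alternating_meet iB jB vi vj) => // eq_ji.
have [_ _ iK] := antipodeP iB; move: rj; rewrite eq_ji iK.
by move/ltn_trans/(_ ri); rewrite ltnn.
Qed.
End OddPaths.

(** Too few alternating paths means many exposed vertices, hence many odd parts. The hitting set is
    the projection of the copies of [A] and of [X'], from which one vertex per part can be
    spared. *)
Theorem breaking_path_duality (T : finType) (e : rel T) (c : T -> bool)
    (A : {set T}) k : symmetric e -> ~ disjoint_breaking_paths e c A k ->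
  exists X : {set T}, #|X| <= 2 * k - 2 /\
    forall x s, breaking_path e c A x s -> exists2 v, v \in x :: s & v \in X.
Proof.
move=> e_sym no_k.
have [f [X' [P [[mf sX'] partP cardP oddP adjP]]]] :=
  gallai_partition (dadj_sym e_sym) (dvert c A).
have lt_k : #|A|.+1 < #|exposed (dvert c A) f| + 2 * k.
  by rewrite ltnNge; apply/negP => /(exposed_breaking_paths mf).
have /and3P[/eqP covP tiP _] := partP.
have inD C x : C \in P -> x \in C -> x \in dvert c A /\ x \notin X'.
  move=> CP xC; apply/setDP; rewrite -covP; apply/bigcupP; by exists C.
have eqC C C' x : C \in P -> C' \in P -> x \in C -> x \in C' -> C = C'.
  by move=> CP C'P xC xC'; rewrite -(def_pblock tiP CP xC) (def_pblock tiP C'P xC').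
(* Candidates for the vertex spared on behalf of [C]. If there were none, [mate] would act on the
   odd set [C] without fixed points. *)
pose marks (C : {set T * bool}) v :=
  [exists i, ((v, i) \in C) && ((v \in A) || ((v, ~~ i) \in X'))].
have marks_ex C : C \in P -> exists v, marks C v.
  move=> CP; apply: NNPP => no_v; have := oddP C CP.
  have mC : {in C, forall x, (x.1 \notin A) /\ mate A x \in C}.
    move=> [v i] vC /=; have : ~~ marks C v by apply/negP => ?; apply: no_v; exists v.
    rewrite negb_exists => /forallP/(_ i); rewrite vC /= negb_or => /andP[vA vX].
    have [vD _] := inD _ _ CP vC; split=> //.
    have em : mate A (v, i) = (v, ~~ i) by rewrite /mate /= (negPf vA).
    apply: (adjP C (v, i)) => //; first by rewrite inE mate_dvert // em vX.
    by rewrite em /dadj /= eqxx; case: (i); rewrite orbT.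
  rewrite (odd_card_involution (@mateK _ A)); last by move=> x /mC[].
  suff -> : [set x in C | mate A x == x] = set0 by rewrite cards0.
  by apply/setP => x; rewrite !inE mate_fix; apply/negP => /andP[/mC[/negPf->]].
pose rep C := [pick v | marks C v].
have repP C v : rep C = Some v -> marks C v.
  by rewrite /rep; case: pickP => // w mw [<-].
have rep_ex C : C \in P -> exists v, rep C = Some v.
  move=> /marks_ex[w mw]; rewrite /rep; case: pickP => [v _|/(_ w)]; first by exists v.
  by rewrite mw.
pose U := A :|: [set x.1 | x in X'].
pose S := [set v | [exists C in P, rep C == Some v]].
have SU : S \subset U.
  apply/subsetP => v; rewrite inE => /exists_inP[C CP /eqP/repP/existsP[i]].
  rewrite !inE => /andP[_ /orP[->//|vX]]; apply/orP; right.
  by apply/imsetP; exists (v, ~~ i).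
have cS : #|P| <= #|S|.
  have rep_inj : {in P &, injective rep}.
    move=> C C' CP C'P eqr; have [v rv] := rep_ex C CP.
    have /existsP[i /andP[vC iX]] := repP C v rv.
    have /existsP[j /andP[vC' jX]] : marks C' v by apply: repP; rewrite -eqr.
    (* A marked vertex has only one copy outside [X'], so it cannot represent two parts. *)
    apply: (eqC C C' (v, i)) => //; suff -> : i = j by [].
    have [+ vX] := inD _ _ CP vC; have [+ vX'] := inD _ _ C'P vC'.
    rewrite !inE /=; move: iX; case: (v \in A) => /=; first by move=> _ /eqP-> /eqP->.
    by move=> iX _ _; move: iX vX'; case: (i); case: (j) => //= ->.
  rewrite -(card_in_imset rep_inj) -(card_imset S (@Some_inj _)).
  apply/subset_leq_card/subsetP => _ /imsetP[C CP ->].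
  have [v rv] := rep_ex C CP; rewrite rv; apply/imset_f; rewrite inE.
  by apply/exists_inP; exists C => //; rewrite rv.
have cU : #|U| <= #|A| + #|X'|.
  apply: leq_trans (leq_card_setU _ _) _; rewrite leq_add2l; exact: leq_imset_card.
(* Its size is at most [#|A| + #|X'| - #|P|], hence at most [#|A| - #|exposed (dvert c A) f|], which
   [lt_k] bounds by [2 * k - 2]. *)
exists (U :\: S); split.
  have := cardsID S U; rewrite (setIidPr SU).
  move: cardP lt_k cS cU; move: #|exposed _ _| #|X'| #|P| #|S| #|U| #|A| #|_ :\: _|.
  lia.
move=> x s [ps us /andP[xA lA] intA oddlen]; apply: NNPP => no_v.
have survive u : u \in x :: s -> u \in U -> exists2 C, C \in P & rep C = Some u.
  move=> us' uU; apply: NNPP => noC; apply: no_v; exists u => //.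
  rewrite inE uU andbT inE; apply/exists_inP => -[C CP /eqP rC].
  by apply: noC; exists C.
(* Lift the path to the doubled graph. Invariant: the current copy lies in a part whose
   representative is no longer ahead, and the remaining parity is breaking. A new part is entered
   only at its own representative, so the walk can never end. *)
have walk s' v i C : path e v s' -> uniq s' -> {subset s' <= x :: s} ->
    {in s', forall w, w \in A -> w = last v s'} -> last v s' \in A ->
    s' != [::] -> C \in P -> (v, i) \in C ->
    (forall u, rep C = Some u -> u \notin s') ->
    c (last v s') = i (+) odd (size s').-1 -> False.
  elim: s' v i C => // u s' IH v i C /= /andP[evu ps'] /andP[us' us''] sub inA lA' _.
  move=> CP vC nrep par; have u_xs : u \in x :: s by apply: sub; rewrite inE eqxx.
  have uA : u \in A -> c u = i /\ s' = [::].
    move=> uA; have := inA u (mem_head _ _) uA.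
    case: (s') us' par => [|a l] /=; first by rewrite addbF.
    by move=> + _ eql; rewrite eql mem_last.
  have stepC C' j : C' \in P -> (u, j) \in C' -> (forall w, rep C' = Some w -> w \notin s') ->
      j = ~~ i -> False.
    move=> C'P uC' nrep' ji; have [s0|s0] := eqVneq s' [::].
      have [+ _] := inD _ _ C'P uC'; rewrite inE /= ji.
      have uA' : u \in A by rewrite s0 in lA'.
      by have [-> _] := uA uA'; rewrite uA'; case: (i).
    apply: (IH u j C') => //.
    - by move=> w ws; apply: sub; rewrite inE ws orbT.
    - by move=> w ws; apply: inA; rewrite inE ws orbT.
    by rewrite ji par; case: (s') s0 => //= a l _; rewrite addNb addbN.
  have [uX|uX] := boolP ((u, i) \in X').
    have uU : u \in U.
      by rewrite inE; apply/orP; right; apply/imsetP; exists (u, i).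
    have [C' C'P rC'] := survive u u_xs uU.
    have /existsP[j /andP[uC' _]] := repP _ _ rC'.
    have [_ uX'] := inD _ _ C'P uC'.
    apply: (stepC C' j) => //; first by move=> w; rewrite rC' => -[<-].
    by case: (j) (i) uX' uX => -[] // /negP.
  have uC : (u, i) \in C.
    apply: (adjP C (v, i)) => //; last by rewrite /dadj /= eqxx evu.
    by rewrite inE uX inE /=; apply/implyP => /uA[->].
  (* A vertex of [U] met inside [C] would be the representative of [C], which is not ahead;
     otherwise the link to the other copy stays in [C]. *)
  have no_rep : u \in U -> (u \in A) || ((u, ~~ i) \in X') -> False.
    move=> uU uAX; have [C' C'P rC'] := survive u u_xs uU.
    have /existsP[j /andP[uC' jX]] := repP _ _ rC'.
    have ji : j = i.
      have [+ uX'] := inD _ _ C'P uC'; rewrite inE /=.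
      move: uAX; have [/uA[-> _] _ /eqP //|_ /= nX _] := boolP (u \in A).
      by case: (j) (i) uX' nX => -[] // /negP.
    rewrite ji in uC'; have eqC' := eqC C C' _ CP C'P uC uC'.
    by have := nrep u; rewrite eqC' rC' inE eqxx => /(_ erefl).
  have [uA'|nA] := boolP (u \in A); first by apply: no_rep; rewrite ?inE uA'.
  have [uX'|nX'] := boolP ((u, ~~ i) \in X').
    apply: no_rep; last by rewrite uX' orbT.
    by rewrite inE; apply/orP; right; apply/imsetP; exists (u, ~~ i).
  apply: (stepC C (~~ i)) => //.
    apply: (adjP C (u, i)) => //; last by rewrite /dadj /= eqxx; case: (i); rewrite orbT.
    by rewrite inE nX' inE /= (negPf nA).
  by move=> w /nrep; rewrite inE negb_or => /andP[].
have xU : x \in U by rewrite inE xA.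
have [C CP rC] := survive x (mem_head _ _) xU.
have /existsP[i /andP[xC _]] := repP _ _ rC.
have ix : i = c x by have [+ _] := inD _ _ CP xC; rewrite inE /= xA => /eqP.
have [nxs us'] := andP us.
have s0 : s != [::] by apply/eqP => s0; move: oddlen; rewrite s0 /= eqxx.
apply: (walk s x i C) => //.
- by move=> w ws; rewrite inE ws orbT.
- move=> w ws wA; have ws2 : w \in x :: s by rewrite inE ws orbT.
  have [wx|//] := intA w ws2 wA.
  by rewrite -wx ws in nxs.
- by move=> w; rewrite rC => -[<-].
move: oddlen; rewrite ix; case: (s) s0 => //= a l _.
by case: (odd _); case: (c x); case: (c _).
Qed.

(** * Ears and bipartite blocks *)

Lemma rev_path_sym (T : Type) (r : rel T) x p : symmetric r ->
  path r (last x p) (rev (belast x p)) = path r x p.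
Proof. by move=> r_sym; rewrite rev_path; apply: eq_path => y z; rewrite r_sym. Qed.

Lemma last_rev_belast (T : Type) (x : T) p : last (last x p) (rev (belast x p)) = x.
Proof. by rewrite -(last_cons x) -rev_rcons -lastI rev_cons last_rcons. Qed.

Lemma cons_rev_belast (T : Type) (x : T) p : last x p :: rev (belast x p) = rev (x :: p).
Proof. by rewrite -rev_rcons -lastI. Qed.

Lemma coloring_parity (T : Type) (c : T -> bool) x r :
  path (fun y z => c y != c z) x r -> odd (size r) = (c x != c (last x r)).
Proof.
elim: r x => [|y r IHr] x /=; first by rewrite eqxx.
by move=> /andP[xy /IHr->]; move: xy; case: (c x); case: (c y); case: (c _).
Qed.

(** * Growing a two-coloured set by ears *)

Section Ears.
Variables (T : finType) (e : rel T) (c : T -> bool) (B : {set T}) (a b : T).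
Hypotheses (e_sym : symmetric e) (e_irr : irreflexive e).
Hypotheses (aB : a \in B) (bB : b \in B) (ab : a != b).
Hypotheses (connB : connected_on e B) (cutB : no_cut_vertex e B).
Hypothesis parityB : forall s, path e a s -> uniq (a :: s) -> {subset a :: s <= B} ->
  last a s = b -> odd (size s) = (c a != c b).

Definition bichromatic (col : T -> bool) : rel T :=
  fun x y => e x y && (col x != col y).

Lemma bichromatic_sym col : symmetric (bichromatic col).
Proof. by move=> x y; rewrite /bichromatic e_sym eq_sym. Qed.

Lemma bichromatic_parity col x s : path (bichromatic col) x s ->
  odd (size s) = (col x != col (last x s)).
Proof.
move=> ps; apply: (coloring_parity (c := col)); apply: sub_path ps => y z.
by case/andP.
Qed.

(** Two disjoint properly coloured paths which extend any path between [u] and [v] running outside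
    [D] to a path between [a] and [b], whose parity is known. *)
Definition linked_to (D : {set T}) col u v : Prop := exists s1 s2,
  [/\ path (bichromatic col) u s1 /\ path (bichromatic col) v s2,
      last u s1 = a /\ last v s2 = b, uniq ((u :: s1) ++ (v :: s2))
    & {subset (u :: s1) ++ (v :: s2) <= D}].

Definition linked D col u v : Prop := linked_to D col u v \/ linked_to D col v u.

Definition good_coloring (D : {set T}) (col : T -> bool) : Prop :=
  [/\ D \subset B, a \in D /\ b \in D, col a = c a /\ col b = c b
    & forall u v, u \in D -> v \in D -> u != v -> linked D col u v].

(** The links complete the ear to a path from [a] to [b] inside [B]. Its parity is prescribed and
    the links are properly coloured, which leaves one parity for the ear. With [r] empty, [col] is
    proper on the edges inside [D]. *)
Lemma ear_parity D col u v r : good_coloring D col -> u \in D -> v \in D ->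
  path e u (rcons r v) -> uniq (u :: rcons r v) ->
  (forall x, x \in r -> (x \in B) && (x \notin D)) -> odd (size r).+1 = (col u != col v).
Proof.
move=> [sDB _ [ca cb] linkD] uD vD.
have main u' v' r' : linked_to D col u' v' -> path e u' (rcons r' v') ->
    uniq (u' :: rcons r' v') -> (forall x, x \in r' -> (x \in B) && (x \notin D)) ->
    odd (size r').+1 = (col u' != col v').
  move=> [s1 [s2 [[p1 p2] [l1 l2] us sub]]] pr ur rD.
  have pe x s : path (bichromatic col) x s -> path e x s.
    by apply: sub_path => y z /andP[].
  have eqs : a :: rev (belast u' s1) ++ rcons r' v' ++ s2 = rev (u' :: s1) ++ r' ++ v' :: s2.
    by rewrite -l1 -cat_cons cons_rev_belast cat_rcons.
  have pq : perm_eq (rev (u' :: s1) ++ r' ++ v' :: s2) (((u' :: s1) ++ v' :: s2) ++ r').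
    by rewrite -catA; apply: perm_cat; [rewrite perm_rev | apply: permEl (perm_catC _ _)].
  have uniq_all : uniq (a :: rev (belast u' s1) ++ rcons r' v' ++ s2).
    rewrite eqs (perm_uniq pq) cat_uniq us.
    have -> : ~~ has (mem ((u' :: s1) ++ v' :: s2)) r'.
      by apply/hasPn => x /rD/andP[_]; apply: contra => /sub.
    by move: ur => /= /andP[_]; rewrite rcons_uniq => /andP[].
  have sub_all : {subset a :: rev (belast u' s1) ++ rcons r' v' ++ s2 <= B}.
    move=> x; rewrite eqs (perm_mem pq) mem_cat => /orP[/sub/(subsetP sDB)//|/rD/andP[]//].
  have path_all : path e a (rev (belast u' s1) ++ rcons r' v' ++ s2).
    have la : last a (rev (belast u' s1)) = u' by rewrite -l1 last_rev_belast.
    by rewrite !cat_path la -{1}l1 rev_path_sym // (pe _ _ p1) pr last_rcons (pe _ _ p2).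
  have := parityB path_all uniq_all sub_all.
  rewrite !last_cat last_rcons => /(_ l2).
  rewrite !size_cat size_rev size_belast size_rcons !oddD /=.
  rewrite (bichromatic_parity p1) (bichromatic_parity p2) l1 l2 ca cb.
  by case: (odd _); case: (col u'); case: (col v'); case: (c a); case: (c b).
move=> pr ur rD; have uv : u != v.
  by apply: contraTneq ur => ->; rewrite /= mem_rcons mem_head.
have [|lvu] := linkD _ _ uD vD uv; first by move/main; apply.
have lr : last u (rcons r v) = v by rewrite last_rcons.
have eqr : v :: rcons (rev r) u = rev (u :: rcons r v).
  by rewrite rev_cons rev_rcons.
rewrite eq_sym -(size_rev r); apply: (main _ _ _ lvu).
- by rewrite -rev_cons -[v in path _ v _]lr -[u :: r](belast_rcons u r v) rev_path_sym.
- by rewrite eqr rev_uniq.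
- by move=> x; rewrite mem_rev; apply: rD.
Qed.

Lemma linked_to_extend (D D' : {set T}) col col' u v x x' p p' : linked_to D col u v ->
  D \subset D' -> {in D, col =1 col'} ->
  path (bichromatic col') x p -> path (bichromatic col') x' p' ->
  last x p = u -> last x' p' = v ->
  uniq (belast x p ++ belast x' p') ->
  (forall w, w \in belast x p ++ belast x' p' -> (w \in D') && (w \notin D)) ->
  linked_to D' col' x x'.
Proof.
move=> [s1 [s2 [[p1 p2] [l1 l2] us sub]]] sDD' eqc px px' lx lx' up nD.
have pe w s : {subset w :: s <= D} -> path (bichromatic col) w s -> path (bichromatic col') w s.
  move=> sw; have -> // : path (bichromatic col') w s = path (bichromatic col) w s.
  apply: (@eq_in_path _ [in D]) => [y z yD zD|].
    by rewrite /bichromatic -!eqc.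
  by apply/allP => y /sw.
have perm : perm_eq ((x :: p ++ s1) ++ x' :: p' ++ s2)
                    ((belast x p ++ belast x' p') ++ (u :: s1) ++ (v :: s2)).
  have -> : x :: p ++ s1 = belast x p ++ (u :: s1).
    by rewrite -cat_cons lastI lx cat_rcons.
  have -> : x' :: p' ++ s2 = belast x' p' ++ (v :: s2).
    by rewrite -cat_cons lastI lx' cat_rcons.
  by rewrite -!catA perm_cat2l perm_catCA.
exists (p ++ s1), (p' ++ s2); split.
- rewrite !cat_path px px' lx lx' !pe //.
    by move=> w ws; apply: sub; rewrite mem_cat ws orbT.
  by move=> w ws; apply: sub; rewrite mem_cat ws.
- by rewrite !last_cat lx lx'.
- rewrite (perm_uniq perm) cat_uniq up us andTb andbT.
  by apply/hasPn => w /sub wD; apply/negP => /nD; rewrite wD andbF.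
- move=> w; rewrite (perm_mem perm) mem_cat => /orP[/nD/andP[]//|/sub].
  exact: (subsetP sDD').
Qed.

(** Colours alternate along the ear, and its parity makes the last edge proper too. Two ear vertices
    leave towards opposite ends of the ear; an ear vertex and [y] in [D] are linked through an end
    different from [y]. *)
Lemma add_ear D col u v r : good_coloring D col -> u \in D -> v \in D ->
  path e u (rcons r v) -> uniq (u :: rcons r v) ->
  (forall x, x \in r -> (x \in B) && (x \notin D)) ->
  exists col', good_coloring (D :|: [set x in r]) col'.
Proof.
move=> gD uD vD pr ur rD; have par := ear_parity gD uD vD pr ur rD.
have [sDB [aD bD] [ca cb] linkD] := gD.
(* Indices in [r] start at [0], so the first inner vertex gets the colour opposite to that of
   [u]. *)
pose col' x := if x \in D then col x else col u (+) ~~ odd (index x r).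
have eqc : {in D, col =1 col'} by move=> x xD; rewrite /col' xD.
have /and3P[nur nvr uniqr] : [&& u \notin rcons r v, v \notin r & uniq r].
  by move: ur; rewrite /= rcons_uniq => /and3P[-> -> ->].
have uv : u != v by apply: contraNneq nur => ->; rewrite mem_rcons mem_head.
have pr' : path (bichromatic col') u (rcons r v).
  apply/(pathP u) => i; rewrite size_rcons ltnS => le_i.
  rewrite /bichromatic (pathP u pr) ?size_rcons //=.
  have colr j : j < size r -> col' (nth u r j) = col u (+) ~~ odd j.
    move=> lt_j; have /rD/andP[_ /negPf nD] := mem_nth u lt_j.
    by rewrite /col' nD index_uniq.
  rewrite -rcons_cons !nth_rcons /= ltnS le_i.
  have -> : col' (nth u (u :: r) i) = col u (+) odd i.
    case: i le_i => [_|i lt_i] /=; first by rewrite -eqc // addbF.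
    by rewrite colr.
  move: le_i; rewrite leq_eqVlt => /orP[/eqP->|lt_i].
    rewrite ltnn eqxx -eqc //; move: par => /=.
    by case: (odd _); case: (col u); case: (col v).
  by rewrite lt_i colr //; case: (odd i); case: (col u).
exists col'; set D' := D :|: _.
have sDD' : D \subset D' := subsetUl _ _.
have rD' x : x \in r -> (x \in D') && (x \notin D).
  by move=> xr; rewrite !inE xr orbT; case/andP: (rD x xr).
have pcat x r1 r2 : r = r1 ++ x :: r2 ->
  path (bichromatic col') x (rcons (rev r1) u) /\ path (bichromatic col') x (rcons r2 v).
  move=> defr; move: pr'; rewrite defr rcons_cat cat_path /=.
  move=> /and3P[p1 p2 p3]; split=> //; rewrite -rev_cons.
  have := rev_path_sym u (rcons r1 x) (bichromatic_sym col').
  by rewrite last_rcons belast_rcons => ->; rewrite rcons_path p1.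
have both x x' r1 r2 r3 : r = r1 ++ x :: r2 ++ x' :: r3 -> linked D' col' x x'.
  move=> defr; have [pxu _] := pcat x _ _ defr.
  have [|_ px'v] := pcat x' (r1 ++ x :: r2) r3; first by rewrite defr -catA.
  have perm : perm_eq r ((x :: rev r1 ++ x' :: r3) ++ r2).
    apply/permP => P; rewrite defr; clear; rewrite !count_cat /= !count_cat /= count_rev.
    lia.
  have ub : uniq ((x :: rev r1) ++ x' :: r3).
    by move: uniqr; rewrite (perm_uniq perm) cat_uniq => /andP[].
  have sb w : w \in (x :: rev r1) ++ x' :: r3 -> (w \in D') && (w \notin D).
    by move=> wr; apply: rD'; rewrite (perm_mem perm) mem_cat wr.
  have [luv|lvu] := linkD _ _ uD vD uv.
    by left; apply: (linked_to_extend luv sDD' eqc pxu px'v);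
      rewrite ?last_rcons ?belast_rcons.
  right; apply: (linked_to_extend lvu sDD' eqc px'v pxu);
    rewrite ?last_rcons ?belast_rcons // 1?uniq_catC //.
  by move=> w; rewrite mem_cat orbC -mem_cat; apply: sb.
have in_r x y : x \in r -> y \in D -> linked D' col' x y.
  move=> xr yD; have [r1 [r2 defr]] : exists r1 r2, r = r1 ++ x :: r2.
    by case/splitPr: xr => r1 r2; exists r1, r2.
  have [pxu pxv] := pcat x _ _ defr.
  have u1 : uniq (x :: rev r1).
    have perm : perm_eq r ((x :: rev r1) ++ r2).
      by apply/permP => P; rewrite defr; clear; rewrite !count_cat /= count_rev; lia.
    by move: uniqr; rewrite (perm_uniq perm) cat_uniq => /andP[].
  have u2 : uniq (x :: r2) by move: uniqr; rewrite defr cat_uniq => /and3P[].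
  have nil_path w : path (bichromatic col') w [::] by [].
  have extend w p : path (bichromatic col') x (rcons p w) -> w \in D -> w != y ->
      uniq (x :: p) -> {subset x :: p <= r} -> linked D' col' x y.
    move=> px wD wy up sp; have [lwy|lyw] := linkD _ _ wD yD wy.
      left; apply: (linked_to_extend lwy sDD' eqc px (nil_path y)) => //;
        rewrite ?last_rcons // belast_rcons cats0 //.
      by move=> z /sp /rD'.
    right; apply: (linked_to_extend lyw sDD' eqc (nil_path y) px) => //;
      rewrite ?last_rcons // belast_rcons //.
    by move=> z /sp /rD'.
  have [yu|yu] := eqVneq y u.
    apply: (extend v r2) => //; first by rewrite yu eq_sym.
    by move=> z zr; rewrite defr mem_cat zr orbT.
  apply: (extend u (rev r1)) => //; first by rewrite eq_sym.
  by move=> z; rewrite inE mem_rev defr mem_cat inE => /orP[->|->]; rewrite ?orbT.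
have linkedC E' col0 x y : linked E' col0 x y -> linked E' col0 y x.
  by case; [right | left].
split.
- by rewrite subUset sDB; apply/subsetP => x; rewrite inE => /rD/andP[].
- by rewrite !inE aD bD.
- by rewrite -!eqc.
move=> x y; rewrite !in_setU ![_ \in [set _ in _]]in_set => /orP[xD|xr] /orP[yD|yr] xy.
- have [lxy|lyx] := linkD _ _ xD yD xy.
    left; apply: (linked_to_extend lxy sDD' eqc (p := [::]) (p' := [::])) => //.
  by right; apply: (linked_to_extend lyx sDD' eqc (p := [::]) (p' := [::])).
- by apply: linkedC; apply: in_r.
- exact: in_r.
have [r1 [r2 defr]] : exists r1 r2, r = r1 ++ x :: r2.
  by case/splitPr: xr => r1 r2; exists r1, r2.
have := yr; rewrite defr mem_cat inE eq_sym (negPf xy) /= => /orP[yr'|yr'].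
  case/splitPr: yr' defr => p1 p2 defr; apply: linkedC; apply: (both y x p1 p2 r2).
  by rewrite defr -catA.
by case/splitPr: yr' defr => p1 p2 defr; apply: (both x y r1 p1 p2).
Qed.

Lemma exit_edge (E D : {set T}) x y : D \subset E -> x \in D -> y \notin D ->
  connect (restr e E) x y -> exists u v, [/\ u \in D, v \notin D, v \in E & e u v].
Proof.
move=> sDE xD yD /connectP[p]; elim: p x xD => [|z p IHp] x xD /=.
  by move=> _ eyx; rewrite eyx xD in yD.
move=> /andP[/and3P[_ zE exz] pz] eyz; have [zD|zD] := boolP (z \in D).
  exact: IHp pz eyz.
by exists x, z.
Qed.

(** An edge [u y] leaves [D], and as [u] is no cut vertex, [y] is joined in [B] without [u] to
    another vertex of [D]. *)
Lemma good_coloring_step D col : good_coloring D col -> D != B ->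
  exists D' col', [/\ good_coloring D' col', D \subset D' & D' != D].
Proof.
move=> gD DB; have [sDB [aD bD] _ _] := gD.
have [y0 y0B y0D] : exists2 y, y \in B & y \notin D.
  apply/subsetPn; apply: contra DB => sBD; by rewrite eqEsubset sDB.
have [u [y [uD yD yB euy]]] := exit_edge sDB aD y0D (connB aB y0B).
have uB := subsetP sDB u uD.
have [w wD wu] : exists2 w, w \in D & w != u.
  have [au|au] := eqVneq a u; last by exists a.
  by exists b => //; rewrite -au eq_sym.
have yu : y != u by apply: contraNneq yD => ->.
have : connect (restr e (B :\ u)) y w.
  by apply: cutB => //; rewrite !inE ?yu ?wu // (subsetP sDB).
case/connectP => p0 /shortenP[p pp up _] lw.
have hasD : has (mem D) (y :: p).
  by apply/hasP; exists w => //; rewrite lw mem_last.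
have pB : {subset y :: p <= B :\ u}.
  have yBu : y \in B :\ u by rewrite !inE yu.
  move=> z; rewrite inE => /orP[/eqP->//|].
  elim: p y pp yBu {up lw hasD yD yB euy yu} => //= z' p IHp y.
  move=> /andP[/and3P[_ z'B _] pz] _; rewrite inE => /orP[/eqP->//|]; exact: IHp pz z'B.
have pe : path e u (y :: p) by rewrite /= euy; apply: sub_path pp => z z' /and3P[].
have uu : uniq (u :: y :: p).
  by rewrite cons_uniq up andbT; apply/negP => /pB; rewrite !inE eqxx.
have hy : head u (y :: p) = y by [].
have pB' z : z \in y :: p -> z \in B by move=> /pB; rewrite inE => /andP[].
(* Cutting at the first vertex of [D] yields the ear. It ends away from [u], and it contains [y], so
   [D] really grows. *)
move: pe uu pB' hy; move: (y :: p) hasD => s hasD; case: (split_find hasD) => v r1 r2 vD r1D.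
rewrite cat_path -cat_cons cat_uniq => /andP[pr _] /andP[ur _] pB' hy.
have rD z : z \in r1 -> (z \in B) && (z \notin D).
  move=> zr; rewrite (hasPn r1D) // andbT pB' // mem_cat mem_rcons inE zr orbT //.
have [col' gcol'] := add_ear gD uD vD pr ur rD.
exists (D :|: [set x in r1]), col'; split=> //; first exact: subsetUl.
have yr1 : y \in r1.
  by case: (r1) hy => [|z l] /= hy; [case/negP: yD; rewrite -hy | rewrite hy mem_head].
by apply: contra yD => /eqP <-; rewrite !inE yr1 orbT.
Qed.

Theorem equal_parity_bipartite : bipartite_on e B.
Proof.
have good0 : good_coloring [set a; b] c.
  split=> //; first by rewrite subUset !sub1set aB.
    by rewrite !inE !eqxx orbT.
  have lab : linked_to [set a; b] c a b.
    exists [::], [::]; split=> //=; first by rewrite inE ab.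
    by move=> x; rewrite !inE.
  move=> u v; rewrite !inE => /orP[]/eqP-> /orP[]/eqP->; rewrite ?eqxx // => _; by [left | right].
have [D [_ [col gD] maxD]] := ex_max_set (P := fun D => exists col, good_coloring D col)
  (ex_intro _ c good0).
have [DB|DB] := eqVneq D B; last first.
  have [D' [col' [gD' sDD' ne]]] := good_coloring_step gD DB.
  by rewrite (maxD D' (ex_intro _ col' gD') sDD') eqxx in ne.
exists col => x y; rewrite -DB => xD yD exy.
have xy : x != y by apply: contraTneq exy => ->; rewrite e_irr.
have := @ear_parity D col x y [::] gD xD yD; rewrite /= exy inE xy.
by move=> /(_ isT isT)/(_ _)/esym; apply.
Qed.
End Ears.

(** * Parity inside a block avoiding the hitting set *)

Section Blocks.
Variables (T : finType) (e : rel T) (c : T -> bool).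
Hypotheses (e_sym : symmetric e) (e_irr : irreflexive e).
Implicit Types A B S X : {set T}.

Lemma restr_sym S : symmetric (restr e S).
Proof. by move=> x y; rewrite /restr /= e_sym andbCA. Qed.

Lemma restr_connect_sym S : connect_sym (restr e S).
Proof. exact: sym_connect_sym (@restr_sym S). Qed.

Lemma path_connect_restr S x p : path e x p -> {subset x :: p <= S} ->
  connect (restr e S) x (last x p).
Proof.
elim: p x => [|y p IHp] x /=; first by rewrite connect0.
move=> /andP[exy py] sub; apply: (@connect_trans _ _ y).
  by apply: connect1; rewrite /restr /= exy !sub ?inE ?eqxx ?orbT.
by apply: IHp py _ => z zp; apply: sub; rewrite inE zp orbT.
Qed.

(** Cut the path at its inner vertices in [A]. The pieces avoid [X], so none is breaking, and
    correct parities add up to a correct parity. *)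
Lemma nonbreaking_parity A X x s :
  (forall y r, breaking_path e c A y r -> exists2 v, v \in y :: r & v \in X) ->
  path e x s -> uniq (x :: s) -> x \in A -> last x s \in A ->
  (forall v, v \in x :: s -> v \notin X) -> odd (size s) = (c x != c (last x s)).
Proof.
move=> hitX; have [n] := ubnP (size s); elim: n => // n IHn in x s *.
rewrite ltnS => le_n ps us xA lA avoid.
case: (classic (exists2 v, v \in s & (v \in A) && (v != last x s))) => [[v vs]|intA].
  case/andP=> vA; case/splitPr: vs ps us lA avoid le_n => s1 s2.
  rewrite -cat_rcons cat_path last_rcons last_cat last_rcons => /andP[p1 p2] us lA avoid.
  rewrite size_cat size_rcons => le_n vl.
  have s2n : s2 != [::] by apply: contraNneq vl => ->.
  have u2 : uniq (v :: s2).
    by move: us; rewrite cat_rcons -cat_cons cat_uniq => /and3P[].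
  have u1 : uniq (x :: rcons s1 v) by move: us; rewrite -cat_cons cat_uniq => /and3P[].
  have i1 := IHn x (rcons s1 v) _ p1 u1 xA.
  have i2 := IHn v s2 _ p2 u2 vA lA.
  rewrite last_rcons size_rcons in i1.
  rewrite oddD i1 ?i2 //.
  - by case: (c x); case: (c v); case: (c _).
  - by apply: leq_trans le_n; rewrite addSn ltnS leq_addl.
  - move=> w; rewrite inE => ws; apply: avoid; rewrite !inE mem_cat mem_rcons inE.
    by case/orP: ws => ->; rewrite ?orbT.
  - apply: leq_trans le_n; rewrite -[ltnLHS]addn0 ltn_add2l.
    by case: (s2) s2n.
  move=> w ws; apply: avoid; rewrite -cat_cons mem_cat ws //.
apply: NNPP => bad; have [|v vxs vX] := hitX x s; last by have := avoid v vxs; rewrite vX.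
split=> //; [by rewrite xA| |by move: bad; case: (odd _); case: (c x == _)].
move=> v; rewrite inE => /orP[/eqP->|vs] vA; first by left.
right; apply/eqP/negPn/negP => vl; apply: intA; exists v => //; by rewrite vA.
Qed.

Lemma block_exists X S : S \subset ~: X -> S != set0 -> connected_on e S ->
  no_cut_vertex e S -> exists2 B : {set T}, S \subset B & is_block_minus e X B.
Proof.
move=> sSX S0 cS nS.
have [B [sSB [BX cB nB] maxB]] := @ex_max_set _ (fun B : {set T} =>
  [/\ B \subset ~: X, connected_on e B & no_cut_vertex e B]) S (And3 sSX cS nS).
exists B => //; split=> //; last by move=> B' sBB' ? ? ?; apply: maxB.
have /set0Pn[x xS] := S0; by apply/set0Pn; exists x; apply: (subsetP sSB).
Qed.

Lemma block_bipartite A X B a b :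
  (forall y r, breaking_path e c A y r -> exists2 v, v \in y :: r & v \in X) ->
  is_block_minus e X B -> a \in A -> b \in A -> a \in B -> b \in B -> a != b ->
  bipartite_on e B.
Proof.
move=> hitX [BX _ cB nB _] aA bA aB bB ab.
apply: (equal_parity_bipartite (c := c) e_sym e_irr aB bB ab cB nB).
move=> s ps us sB ls; rewrite -ls; apply: (nonbreaking_parity hitX) => //.
  by rewrite ls.
by move=> v /sB/(subsetP BX); rewrite inE.
Qed.
End Blocks.

(** * Odd minors from connected bags *)

Section SpanningTree.
Variables (T : finType) (r : rel T) (S : {set T}).
Hypothesis r_sym : symmetric r.

Definition spanning (F : rel T) : Prop :=
  [/\ forall x y, F x y -> [&& x \in S, y \in S & r x y], symmetric F & connected_on F S].

Definition remove_edge (F : rel T) a b : rel T :=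
  fun x y => F x y && ~~ (((x == a) && (y == b)) || ((x == b) && (y == a))).

Lemma remove_cycle_edge F x y l : spanning F -> 3 <= size (x :: y :: l) ->
  uniq (x :: y :: l) -> cycle F (x :: y :: l) -> spanning (remove_edge F x y).
Proof.
move=> [sF F_sym connF] sz ul cyc.
have F'_sym : symmetric (remove_edge F x y).
  by move=> u v; rewrite /remove_edge F_sym orbC [(v == x) && _]andbC [(v == y) && _]andbC.
split=> //; first by move=> u v /andP[/sF].
move=> u v uS vS.
have csym := sym_connect_sym (restr_sym F'_sym S).
have memS a b : F a b -> (a \in S) && (b \in S) by case/sF/and3P => -> ->.
have keep a b : F a b -> a != x -> (a != y) || (b != x) -> restr (remove_edge F x y) S a b.
  move=> ab ax aybx; rewrite /restr /= /remove_edge ab (negPf ax) /= negb_and aybx.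
  by case/andP: (memS _ _ ab) => -> ->.
(* The rest of the cycle still joins the ends of the removed edge. *)
have cyx : connect (restr (remove_edge F x y) S) y x.
  move: cyc => /= /andP[xy]; case: l sz ul => // z l _ ul /= /andP[yz pz].
  have [xny xnz] : x != y /\ x != z.
    by move: ul => /= /and3P[]; rewrite !inE !negb_or => /and3P[-> -> _].
  apply: (@connect_trans _ _ z).
    by apply: connect1; apply: keep; rewrite // eq_sym ?xny // xnz orbT.
  have nl a : a \in z :: l -> (a != x) && (a != y).
    move=> al; move: ul; rewrite !cons_uniq => /and3P[nx ny _].
    apply/andP; split; [apply: contraNneq nx => <- | apply: contraNneq ny => <- //].
    by rewrite inE al orbT.
  elim: l z pz nl {yz ul xnz} => [|a l IHl] z /= /andP[za pa] nl.
    by apply: connect1; have /andP[zx zy] := nl z (mem_head _ _); apply: keep; rewrite ?zy.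
  apply: (@connect_trans _ _ a).
    by apply: connect1; have /andP[zx zy] := nl z (mem_head _ _); apply: keep; rewrite ?zy.
  by apply: IHl pa _ => b bl; apply: nl; rewrite inE bl orbT.
have := connF u v uS vS; apply: connect_sub => a b /and3P[aS bS ab].
case ex: (((a == x) && (b == y)) || ((a == y) && (b == x))); last first.
  by apply: connect1; rewrite /restr /= aS bS /remove_edge ab ex.
case/orP: ex => /andP[/eqP-> /eqP->] //; by rewrite csym.
Qed.

(** A connected spanning subrelation with fewest edges has no cycle, since any edge of a cycle could
    be dropped. *)
Lemma spanning_tree_exists : S != set0 -> connected_on r S ->
  exists F : rel T, is_tree S F /\ forall x y, F x y -> r x y.
Proof.
move=> S0 connS.
have spr : spanning (restr r S).
  split=> // [x y|x y xS yS]; first exact: restr_sym.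
  apply: connect_sub (connS x y xS yS) => u v uv; apply: connect1.
  by move: (uv); rewrite /restr /= => /and3P[-> -> ->].
have [F [spF minF]] := @ex_min_measure _ spanning (fun F => #|[set xy | F xy.1 xy.2]|)
  (ex_intro _ _ spr).
have [sF F_sym connF] := spF.
exists F; split; last by move=> x y /sF/and3P[].
split=> // [x y /sF/and3P[-> ->] //|[l [sz ul cyc]]].
case: l sz ul cyc => // x [|y l] // sz ul cyc.
have := minF _ (remove_cycle_edge spF sz ul cyc); rewrite leqNgt => /negP; apply.
apply: proper_card; apply/properP; split.
  by apply/subsetP => -[u v]; rewrite !inE => /andP[].
exists (x, y); rewrite inE /=; first by move: cyc => /= /andP[].
by rewrite /remove_edge !eqxx andbF.
Qed.
End SpanningTree.

(** Spanning trees of the bags in the graph of bichromatic edges are the required trees. The index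
    type singles out [None] for the one tree that contains no breaking path. *)
Lemma odd_minor_of_bags (T : finType) (e : rel T) k (bag : option 'I_k -> {set T})
    (alpha : T -> bool) : symmetric e ->
  (forall o, bag o != set0) ->
  (forall o, connected_on (bichromatic e alpha) (bag o)) ->
  (forall o o' v, v \in bag o -> v \in bag o' -> o = o') ->
  (forall o o', o != o' -> exists x y,
     [/\ x \in bag o, y \in bag o', e x y & alpha x == alpha y]) ->
  odd_Kt_minor e k.+1.
Proof.
move=> e_sym bag0 conn disj mono.
pose b (u : 'I_k.+1) := bag (unlift ord_max u).
have unlift_inj (u v : 'I_k.+1) : unlift ord_max u = unlift ord_max v -> u = v.
  by case: unliftP => [i ->|->]; case: unliftP => [j ->|->] // [->].
have tree o : exists F : rel T, is_tree (bag o) F /\ forall x y, F x y -> bichromatic e alpha x y.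
  by apply: spanning_tree_exists => //; apply: bichromatic_sym.
have [F FP] := fin_all_exists tree.
exists b, (fun u => F (unlift ord_max u)), alpha; split.
- by move=> u; have [treeF biF] := FP (unlift ord_max u); split=> // x y /biF/andP[].
- move=> u v uv; rewrite -setI_eq0; apply/eqP/setP => x; rewrite !inE; apply/negP => /andP[xu xv].
  by rewrite (unlift_inj _ _ (disj _ _ _ xu xv)) eqxx in uv.
- by move=> u x y; have [_ biF] := FP (unlift ord_max u) => /biF/andP[].
by move=> u v uv; apply: mono; apply: contra uv => /eqP/unlift_inj->.
Qed.

Lemma path_infix2 (T : eqType) (pre : seq T) x s :
  path (fun y z => infix [:: y; z] (pre ++ x :: s)) x s.
Proof.
elim: s pre x => //= y s IHs pre x; rewrite -cat_rcons IHs andbT.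
by apply/infixP; exists pre, s; rewrite cat_rcons.
Qed.

Lemma breaking_path_rev (T : finType) (e : rel T) c A x s : symmetric e ->
  breaking_path e c A x s -> breaking_path e c A (last x s) (rev (belast x s)).
Proof.
move=> e_sym [ps us /andP[xA lA] intA par].
split; rewrite ?cons_rev_belast ?last_rev_belast ?xA ?lA //.
- by rewrite rev_path_sym.
- by rewrite rev_uniq.
- by move=> v; rewrite mem_rev => /intA h /h []; [right | left].
by rewrite size_rev size_belast par eq_sym.
Qed.

(* List [B] first among the indices and [A] first among the elements of [W]. *)
Lemma injective_assignment (I J : finType) (W A : {set I}) (B : {set J}) :
  A \subset W -> #|B| <= #|A| -> #|J| < #|W| ->
  exists om : option J -> I, [/\ injective om, (forall o, om o \in W)
    & forall j, j \in B -> om (Some j) \in A].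
Proof.
move=> sAW leBA ltJW; have /card_gt0P[w0 _] : 0 < #|W| by apply: leq_ltn_trans ltJW.
pose Lw := enum A ++ enum (W :\: A); pose Lj := enum B ++ enum (~: B).
have uLw : uniq Lw.
  rewrite cat_uniq !enum_uniq andbT /=; apply/hasPn => w.
  by rewrite !mem_enum inE => /andP[].
have sLw : size Lw = #|W|.
  by rewrite size_cat -!cardE -(cardsID A W) (setIidPr sAW).
have memLw w : w \in Lw -> w \in W.
  by rewrite mem_cat !mem_enum inE => /orP[/(subsetP sAW)//|/andP[]].
have memLj j : j \in Lj by rewrite mem_cat !mem_enum inE; case: (j \in B).
have sLj : size Lj = #|J| by rewrite size_cat -!cardE cardsC.
pose pos (o : option J) := if o is Some j then index j Lj else #|J|.
have pos_lt o : pos o < size Lw.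
  by case: o => [j|] /=; rewrite sLw // (leq_trans _ (ltnW ltJW)) // -sLj index_mem.
have pos_inj : injective pos.
  have lt_pos j : index j Lj < #|J| by rewrite -sLj index_mem.
  move=> [j|] [j'|] //= eq_pos.
  - by rewrite -(nth_index j (memLj j)) eq_pos nth_index.
  - by have := lt_pos j; rewrite eq_pos ltnn.
  by have := lt_pos j'; rewrite -eq_pos ltnn.
exists (fun o => nth w0 Lw (pos o)); split.
- move=> o o' /eqP; rewrite nth_uniq // => /eqP; exact: pos_inj.
- by move=> o; apply: memLw; apply: mem_nth.
move=> j jB /=; have lt_j : index j Lj < #|A|.
  by rewrite index_cat mem_enum jB; apply: leq_trans leBA; rewrite cardE index_mem mem_enum.
by rewrite nth_cat -cardE lt_j -mem_enum mem_nth // -cardE.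
Qed.

(** * The subdivision *)

Section Subdivision.
Variables (T : finType) (e : rel T) (s t : nat).
Hypothesis e_sym : symmetric e.
Notation V := (KI_vertex s t).
Notation adj := (@KI_adj s t).
Variables (phi : V -> T) (P : V -> V -> seq T) (c : T -> bool).
Hypothesis phi_inj : injective phi.
Hypothesis P_spec : forall a b, adj a b ->
  [/\ path e (phi a) (rcons (P a b) (phi b)), uniq (phi a :: rcons (P a b) (phi b)),
      P b a = rev (P a b), (forall x, x \in P a b -> x \notin codom phi)
    & path (fun x y => c x != c y) (phi a) (rcons (P a b) (phi b))].
Hypothesis P_disj : forall a b a' b', adj a b -> adj a' b' ->
  ~~ (((a == a') && (b == b')) || ((a == b') && (b == a'))) ->
  forall x, x \in P a b -> x \notin P a' b'.

Lemma adj_sym a b : adj a b = adj b a.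
Proof. by rewrite /KI_adj eq_sym orbC. Qed.

Lemma P_sym a b x : adj a b -> (x \in P b a) = (x \in P a b).
Proof. by case/P_spec => _ _ -> _ _; rewrite mem_rev. Qed.

Lemma P_meet a b a' b' x : adj a b -> adj a' b' -> x \in P a b -> x \in P a' b' ->
  (a = a' /\ b = b') \/ (a = b' /\ b = a').
Proof.
move=> ab ab' xP xP'; have := contraTN (fun ne => P_disj ab ab' ne xP) xP'.
by rewrite negbK => /orP[/andP[/eqP-> /eqP->]|/andP[/eqP-> /eqP->]]; [left | right].
Qed.

Lemma P_nphi a b x v : adj a b -> x \in P a b -> x != phi v.
Proof.
by case/P_spec => _ _ _ nx _ /nx; apply: contraNneq => ->; apply: codom_f.
Qed.

Definition alive (Y : {set T}) a b : bool :=
  [&& adj a b, phi a \notin Y, phi b \notin Y & all (fun x => x \notin Y) (P a b)].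

(* The paths joining [u] to [v] directly ([None]) or through [w] ([Some w]). *)
Definition route u v (w : option V) : seq T :=
  if w is Some w then phi w :: P u w ++ P w v else P u v.

Definition routable u v (w : option V) : bool :=
  if w is Some w then adj u w && adj w v else adj u v.

Lemma adj_neq a b : adj a b -> a != b.
Proof. by case/andP. Qed.

Lemma route_inj u v w w' x : u != v -> routable u v w -> routable u v w' ->
  x \in route u v w -> x \in route u v w' -> w = w'.
Proof.
move=> uv.
have phiP a b z : adj a b -> phi z \in P a b -> False.
  by move=> ab /(P_nphi z ab); rewrite eqxx.
have half z : adj u z && adj z v -> x \in P u z ++ P z v ->
    exists a, [/\ adj a z, (a == u) || (a == v) & x \in P a z].
  case/andP=> uz zv; rewrite mem_cat => /orP[xP|xP].
    by exists u; rewrite eqxx.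
  by exists v; rewrite eqxx orbT adj_sym zv P_sym ?xP.
have ends z a : adj u z && adj z v -> (a == u) || (a == v) -> z != a.
  by case/andP=> /adj_neq uz /adj_neq zv /orP[/eqP->|/eqP->]; rewrite // eq_sym.
have direct w1 : adj u w1 && adj w1 v -> adj u v ->
    (x == phi w1) || (x \in P u w1 ++ P w1 v) -> x \in P u v -> False.
  move=> r1 r2 /orP[/eqP-> /(phiP _ _ _ r2)//|/(half _ r1)[a [az au xa]] xP].
  have [[_ eq1]|[_ eq1]] := P_meet az r2 xa xP.
    by have := ends w1 v r1; rewrite eq1 !eqxx orbT => /(_ isT).
  by have := ends w1 u r1; rewrite eq1 !eqxx => /(_ isT).
case: w => [w|]; case: w' => [w'|] //= rw rw'; rewrite ?inE.
- move=> /orP[/eqP xw|xw] /orP[/eqP xw'|xw'].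
  + by congr Some; apply: phi_inj; rewrite -xw.
  + have [a [az _ xa]] := half w' rw' xw'.
    by case: (phiP a w' w az); rewrite -xw.
  + have [a [az _ xa]] := half w rw xw.
    by case: (phiP a w w' az); rewrite -xw'.
  have [a [az au xa]] := half w rw xw; have [a' [az' au' xa']] := half w' rw' xw'.
  have [[_ ->]//|[_ eq1]] := P_meet az az' xa xa'.
  by have := ends w a' rw au'; rewrite eq1 eqxx.
- by move=> xw xP; case: (direct w rw rw' xw xP).
- by move=> xP xw; case: (direct w' rw' rw xw xP).
Qed.

(** Each vertex of the complete part gives the route through it. If it is [u] or [v], its index is
    reassigned to the direct route, and when both are in the complete part the second index goes
    through a vertex of the edgeless part. *)
Lemma routes_exist u v : 0 < t -> u != v ->
  exists m : 'I_s -> option V, injective m /\ forall k, routable u v (m k).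
Proof.
move=> t0 uv; pose i0 := Ordinal t0.
exists (fun k => if inl k == u then None
  else if inl k == v then (if Defs.is_inl u then Some (inr i0) else None)
  else Some (inl k)).
split=> [k k'|k].
  case: (eqVneq (inl k) u) => [ku|ku]; case: (eqVneq (inl k') u) => [ku'|ku'].
  - by move=> _; move: ku'; rewrite -ku => -[].
  - by rewrite -ku /=; case: ifP.
  - by rewrite -ku' /=; case: ifP.
  case: (eqVneq (inl k) v) => [kv|kv]; case: (eqVneq (inl k') v) => [kv'|kv'].
  - by move=> _; move: kv'; rewrite -kv => -[].
  - by case: ifP.
  - by case: ifP.
  by case.
case: (eqVneq (inl k) u) => [ku|ku] /=; first by rewrite /KI_adj uv -ku.
case: (eqVneq (inl k) v) => [kv|kv].
  by case: u uv {ku} => [i|i] uv /=; rewrite /KI_adj ?uv -kv.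
by rewrite /= /KI_adj eq_sym ku kv /= orbT.
Qed.

(** The [s] routes are pairwise disjoint, so fewer than [s] vertices cannot meet them all. *)
Lemma alive_route (Y : {set T}) u v : 0 < t -> #|Y| < s -> u != v ->
  phi u \notin Y -> phi v \notin Y ->
  alive Y u v \/ exists w, alive Y u w /\ alive Y w v.
Proof.
move=> t0 ltY uv uY vY; have [m [m_inj m_r]] := routes_exist t0 uv.
case: (classic (exists k, {in route u v (m k), forall x, x \notin Y})) => [[k]|hit].
  have := m_r k; case: (m k) => [w|] /=; last first.
    by move=> adj_uv nY; left; rewrite /alive adj_uv uY vY; apply/allP.
  case/andP=> uw wv nY; right; exists w.
  have wY : phi w \notin Y by apply: nY; rewrite inE eqxx.
  by split; rewrite /alive ?uw ?wv ?uY ?vY wY; apply/allP => x xP;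
    apply: nY; rewrite inE mem_cat xP ?orbT.
have hitk k : exists x, (x \in Y) && (x \in route u v (m k)).
  apply: NNPP => no; apply: hit; exists k => x xr; apply/negP => xY.
  by apply: no; exists x; rewrite xY.
have [g gP] := fin_all_exists hitk.
have g_inj : injective g.
  move=> k k' eqg; apply: m_inj; have /andP[_ r1] := gP k; have /andP[_ r2] := gP k'.
  by rewrite eqg in r1; apply: (route_inj uv (m_r k) (m_r k') r1 r2).
move: ltY; rewrite ltnNge => /negP; case.
rewrite -[s]card_ord -(card_imset _ g_inj); apply/subset_leq_card/subsetP => _ /imsetP[k _ ->].
by case/andP: (gP k).
Qed.
(** Subdivided edges met by [X] lose all their inner vertices, so that no dangling pieces remain. *)
Definition core (X : {set T}) : {set T} :=
  [set x | (x \notin X) &&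
           ((x \in codom phi) || [exists ab, alive X ab.1 ab.2 && (x \in P ab.1 ab.2)])].

Lemma alive_core X a b x : alive X a b -> x \in phi a :: rcons (P a b) (phi b) ->
  x \notin X /\ x \in core X.
Proof.
move=> al; have /and4P[_ aX bX /allP pX] := al.
rewrite inE mem_rcons inE => /or3P[/eqP->|/eqP->|xP]; rewrite inE ?aX ?bX ?codom_f //=.
rewrite pX //; split=> //; apply/orP; right; apply/existsP; exists (a, b).
by rewrite al.
Qed.

(** Serves for connectivity with [Y = X] and for the absence of cut vertices with one more vertex in
    [Y]. Branch vertices are joined by surviving routes. *)
Lemma core_connected (X Y : {set T}) : 0 < t -> X \subset Y -> #|Y| < s ->
  {in Y :\: X &, forall x y, x = y} -> connected_on e (core X :\: Y).
Proof.
move=> t0 sXY ltY oneY; set E := core X :\: Y.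
have memE a b x : alive X a b -> x \in phi a :: rcons (P a b) (phi b) ->
    x \notin Y -> x \in E.
  by move=> al xP xY; rewrite inE xY; have [_ ->] := alive_core al xP.
have aliveE a b : alive Y a b -> connect (restr e E) (phi a) (phi b).
  move=> alY; have /and4P[ab aY bY /allP pY] := alY.
  have alX : alive X a b.
    have nY x : x \notin Y -> x \notin X by apply: contra; apply: (subsetP sXY).
    by apply/and4P; split; rewrite ?nY //; apply/allP => x /pY; apply: nY.
  have [pe _ _ _ _] := P_spec ab.
  have := @path_connect_restr _ e E _ _ pe; rewrite last_rcons; apply.
  by move=> x xP; apply: (memE _ _ _ alX xP); have [] := alive_core alY xP.
have branchE a b : phi a \notin Y -> phi b \notin Y -> connect (restr e E) (phi a) (phi b).
  move=> aY bY; have [->//|ab] := eqVneq a b.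
  have [/aliveE//|[w [/aliveE aw /aliveE wb]]] := alive_route t0 ltY ab aY bY.
  exact: connect_trans aw wb.
have symE := restr_connect_sym e_sym E.
(* The subdivided edge through [z] avoids [X], so [Y] has at most one vertex on it and at least one
   of the two ways from [z] to its ends is free. *)
have toBranch z : z \in E -> exists2 a, phi a \notin Y & connect (restr e E) z (phi a).
  rewrite !inE => /and3P[zY _ /orP[/codomP[a defz]|/existsP[[a b] /= /andP[al zP]]]].
    by exists a; rewrite -defz ?connect0.
  have /and4P[ab _ _ _] := al; have [pe ue _ _ _] := P_spec ab.
  have [p1 [p2 defP]] : exists p1 p2, P a b = p1 ++ z :: p2.
    by case/splitPr: zP => p1 p2; exists p1, p2.
  have inE' x := memE a b x al; have inC x := @alive_core X a b x al.
  move: inE' inC pe ue; rewrite defP rcons_cat rcons_cons -cat_rcons => inE' inC pe ue.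
  move: (pe); rewrite cat_path last_rcons => /andP[pe1 pe2].
  have [hasY1|nY1] := boolP (has (mem Y) (phi a :: p1)); last first.
    have Y1 x : x \in phi a :: p1 -> x \notin Y by move/(hasPn nY1).
    exists a; first by apply: Y1; rewrite mem_head.
    rewrite symE; have := @path_connect_restr _ e E _ _ pe1; rewrite last_rcons; apply; move=> x xp.
    apply: inE'; first by rewrite -cat_cons mem_cat xp.
    move: xp; rewrite -rcons_cons mem_rcons inE => /orP[/eqP->//|]; exact: Y1.
  have [hasY2|nY2] := boolP (has (mem Y) (rcons p2 (phi b))); last first.
    have Y2 x : x \in rcons p2 (phi b) -> x \notin Y by move/(hasPn nY2).
    exists b; first by apply: Y2; rewrite mem_rcons mem_head.
    have := @path_connect_restr _ e E _ _ pe2; rewrite last_rcons; apply; move=> x xp.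
    apply: inE'.
      rewrite -cat_cons mem_cat; move: xp; rewrite inE => /orP[/eqP->|->]; rewrite ?orbT //.
      by rewrite -rcons_cons mem_rcons mem_head.
    move: xp; rewrite inE => /orP[/eqP->//|]; exact: Y2.
  have /hasP[x1 x1p x1Y] := hasY1; have /hasP[x2 x2p x2Y] := hasY2.
  have x1p' : x1 \in phi a :: rcons p1 z by rewrite -rcons_cons mem_rcons inE x1p orbT.
  have eq12 : x1 = x2.
    apply: oneY; apply/setDP; split=> //.
      by have [] := inC x1 _; rewrite -?cat_cons ?mem_cat ?x1p'.
    by have [] := inC x2 _; rewrite -?cat_cons ?mem_cat ?x2p ?orbT.
  move: ue; rewrite -cat_cons cat_uniq => /and3P[_ /hasPn/(_ x2 x2p)].
  by rewrite -eq12 /= x1p'.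
move=> x y /toBranch[a aY xa] /toBranch[b bY yb].
apply: connect_trans xa _; apply: connect_trans (branchE a b aY bY) _.
by rewrite symE.
Qed.

Lemma core_subset X : core X \subset ~: X.
Proof. by apply/subsetP => x; rewrite !inE => /andP[]. Qed.

(** Of the [3t - 2] branch vertices at least [t + 2] survive. If only that many do, [X] consists of
    branch vertices; among three surviving pairwise adjacent ones two have the same colour, and the
    untouched path between them has an inner vertex. *)
Lemma core_card (X : {set T}) : 2 <= t -> s = 2 * t - 2 -> #|X| <= 2 * t - 4 ->
  t + 3 <= #|core X| /\
  exists a b, [/\ a != b, phi a \in core X & phi b \in core X].
Proof.
move=> t2 es leX; pose Q := [set v | phi v \in X].
have leQ : #|Q| <= #|X|.
  rewrite -(card_imset _ phi_inj); apply/subset_leq_card/subsetP => _ /imsetP[v vQ ->].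
  by rewrite inE in vQ.
have cV : #|V| = s + t by rewrite card_sum !card_ord.
have cQ : #|~: Q| = s + t - #|Q| by rewrite -cV -(cardsC Q) addKn.
have inC v : (v \in ~: Q) -> phi v \in core X by rewrite !inE codom_f andbT.
have subC : phi @: (~: Q) \subset core X.
  by apply/subsetP => _ /imsetP[v vQ ->]; apply: inC.
have leC : s + t - #|Q| <= #|core X|.
  by rewrite -cQ -(card_imset _ phi_inj); apply: subset_leq_card.
pose QK := [set i : 'I_s | inl i \notin Q].
have leQK : s - #|Q| <= #|QK|.
  have : #|~: QK| <= #|Q|.
    have inlI : injective (inl : 'I_s -> V) by move=> i j [].
    rewrite -(card_imset _ inlI); apply/subset_leq_card/subsetP => _ /imsetP[i iQ ->].
    by move: iQ; rewrite !inE negbK.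
  by have := cardsC QK; rewrite card_ord; lia.
have [i [j [iQ jQ ij]]] : exists i j, [/\ inl i \notin Q, inl j \notin Q & i != j :> 'I_s].
  have : 1 < #|QK| by lia.
  by case/card_gt1P => i [j [iQ jQ ij]]; exists i, j; rewrite !inE in iQ jQ *; split.
split; last first.
  exists (inl i), (inl j); split; [|by apply: inC; rewrite inE..].
  by apply: contra ij => /eqP[->].
have [lt_q|ge_q] := ltnP #|Q| (2 * t - 4); first by lia.
have eqX : phi @: Q = X.
  apply/eqP; rewrite eqEcard card_imset //; apply/andP; split; last by lia.
  by apply/subsetP => _ /imsetP[v vQ ->]; rewrite inE in vQ.
have [w [wQ wi wj]] : exists w, [/\ w \notin Q, w != inl i & w != inl j].
  have : 0 < #|~: Q :\: [set inl i; inl j]|.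
    have := cardsID [set inl i; inl j] (~: Q).
    have : #|~: Q :&: [set inl i; inl j]| <= 2.
      by apply: leq_trans (subset_leq_card (subsetIr _ _)) _; rewrite cards2; case: (_ != _).
    rewrite cQ; move: #|_ :&: _| #|_ :\: _| => n1 n2; lia.
  rewrite card_gt0 => /set0Pn[w]; rewrite !inE negb_or => /andP[/andP[wi wj] wQ].
  by exists w; rewrite inE.
have alive_all a b : a \notin Q -> b \notin Q -> adj a b -> alive X a b.
  move=> aQ bQ ab; apply/and4P; split=> //; [by rewrite inE in aQ|by rewrite inE in bQ|].
  apply/allP => x xP; rewrite -eqX; apply/imsetP => -[v _ defx].
  by have := P_nphi v ab xP; rewrite defx eqxx.
have inner a b : a \notin Q -> b \notin Q -> adj a b -> c (phi a) = c (phi b) ->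
    t + 3 <= #|core X|.
  move=> aQ bQ ab cab; have [_ _ _ nc] := P_spec ab.
  case defP: (P a b) => [|x p] /=; first by rewrite cab eqxx.
  move=> _; have xP : x \in P a b by rewrite defP mem_head.
  have [_ xC] : x \notin X /\ x \in core X.
    by apply: (alive_core (alive_all a b aQ bQ ab)); rewrite defP !inE eqxx orbT.
  have : #|phi @: (~: Q)| < #|core X|.
    apply: proper_card; apply/properP; split=> //; exists x => //.
    by apply/imsetP => -[v _ defx]; have := nc x xP; rewrite defx codom_f.
  rewrite (card_imset _ phi_inj) cQ; move: leQ leX ge_q t2 es.
  by move: #|core X| #|X| #|Q|; clear; lia.
have ijA : adj (inl i) (inl j).
  by rewrite /KI_adj orTb andbT; apply: contra ij => /eqP[->].
have iwA : adj (inl i) w by rewrite /KI_adj eq_sym wi.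
have jwA : adj (inl j) w by rewrite /KI_adj eq_sym wj.
case: (eqVneq (c (phi (inl i))) (c (phi (inl j)))) => [|nij]; first exact: inner.
case: (eqVneq (c (phi (inl i))) (c (phi w))) => [|niw]; first exact: inner.
apply: (inner (inl j) w) => //.
by move: nij niw; case: (c _); case: (c _); case: (c _).
Qed.

(** * Edges of the subdivision and the cost of leaving it *)

Definition branches : {set T} := [set x in codom phi].
Definition hpath a b : seq T := phi a :: rcons (P a b) (phi b).

Arguments hpath : simpl never.

Definition hedge x y : bool :=
  [exists ab, adj ab.1 ab.2 && infix [:: x; y] (hpath ab.1 ab.2)].

Lemma hedgeP x y :
  reflect (exists a b, adj a b /\ infix [:: x; y] (hpath a b)) (hedge x y).
Proof.
apply: (iffP existsP) => [[[a b] /andP[]]|[a [b [ab xy]]]]; first by exists a, b.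
by exists (a, b); apply/andP.
Qed.

Lemma hpath_rev a b : adj a b -> hpath b a = rev (hpath a b).
Proof. by case/P_spec => _ _ Pba _ _; rewrite /hpath Pba rev_cons rev_rcons. Qed.

Lemma hedge_sym : symmetric hedge.
Proof.
suff h x y : hedge x y -> hedge y x by move=> x y; apply/idP/idP; apply: h.
case/hedgeP => a [b [ab xy]]; apply/hedgeP; exists b, a; rewrite adj_sym; split=> //.
by rewrite hpath_rev // -[[:: y; x]]/(rev [:: x; y]) infix_rev.
Qed.

Lemma hpath_hedge a b : adj a b -> path hedge (phi a) (rcons (P a b) (phi b)).
Proof.
move=> ab; apply: sub_path (path_infix2 [::] _ _) => x y xy.
by apply/hedgeP; exists a, b.
Qed.

Lemma hedge_inner a b x y : adj a b -> x \in P a b -> hedge x y -> y \in hpath a b.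
Proof.
move=> ab xP /hedgeP[a' [b' [ab' inf]]].
have [x_in y_in] : x \in hpath a' b' /\ y \in hpath a' b'.
  by split; apply: (mem_infix inf); rewrite !inE eqxx ?orbT.
have xP' : x \in P a' b'.
  move: x_in; rewrite inE mem_rcons inE => /or3P[/eqP eqx|/eqP eqx|//].
    by have := P_nphi a' ab xP; rewrite eqx eqxx.
  by have := P_nphi b' ab xP; rewrite eqx eqxx.
case: (P_meet ab ab' xP xP') => [[-> ->]//|[-> ->]].
by rewrite hpath_rev // mem_rev.
Qed.

(** A subdivided edge can be left only through its ends, so a walk in the subdivision started inside
    it first meets a branch vertex at one of them. *)
Lemma hedge_walk a b x r : adj a b -> x \in P a b -> path hedge x r ->
  (forall v, v \in r -> v \in branches -> v = last x r) -> last x r \in branches ->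
  uniq (x :: r) -> last x r = phi a \/ last x r = phi b.
Proof.
move=> ab; elim: r x => [|y r IHr] x /= xP.
  by rewrite inE => _ _ /codomP[v eqx]; have := P_nphi v ab xP; rewrite eqx eqxx.
move=> /andP[xy pr] inA lA /andP[_ ur].
have := hedge_inner ab xP xy; rewrite inE mem_rcons inE => /or3P[/eqP eqy|/eqP eqy|yP].
- by left; rewrite -eqy; apply/esym/inA; rewrite ?mem_head // inE eqy codom_f.
- by right; rewrite -eqy; apply/esym/inA; rewrite ?mem_head // inE eqy codom_f.
by apply: IHr => // v vr; apply: inA; rewrite inE vr orbT.
Qed.

Definition cost x r : nat := count negb (pairmap hedge x r).

Lemma cost_cat x r1 r2 : cost x (r1 ++ r2) = cost x r1 + cost (last x r1) r2.
Proof. by rewrite /cost pairmap_cat count_cat. Qed.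

Lemma cost_eq0 x r : (cost x r == 0) = path hedge x r.
Proof.
by rewrite /cost; elim: r x => //= y r IHr x; rewrite addn_eq0 IHr eqb0 negbK.
Qed.

Lemma cost_rev x r : cost (last x r) (rev (belast x r)) = cost x r.
Proof.
elim/last_ind: r => // r y IHr; rewrite last_rcons belast_rcons -cons_rev_belast.
rewrite -cats1 cost_cat -IHr addnC.
by rewrite /cost /= addn0 hedge_sym.
Qed.

(** * Cheapest families of disjoint breaking paths *)

Section Families.
Variable k : nat.
Implicit Types p : 'I_k -> T * seq T.

Definition vertices_of p j : seq T := (p j).1 :: (p j).2.

Definition breaking_family p : Prop :=
  (forall j, breaking_path e c branches (p j).1 (p j).2) /\
  (forall i j v, v \in vertices_of p i -> v \in vertices_of p j -> i = j).

Definition total_cost p : nat := \sum_j cost (p j).1 (p j).2.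

Definition cheapest p : Prop :=
  breaking_family p /\ forall p', breaking_family p' -> total_cost p <= total_cost p'.

Definition exchange p j q : 'I_k -> T * seq T := fun i => if i == j then q else p i.

Lemma exchange_family p j q : breaking_family p -> breaking_path e c branches q.1 q.2 ->
  (forall v i, v \in q.1 :: q.2 -> v \in vertices_of p i -> i = j) ->
  breaking_family (exchange p j q).
Proof.
move=> [brk disj] brkq disjq; split=> [i|i i' v]; rewrite /vertices_of /exchange.
  by case: ifP.
case: eqP => [->|_]; case: eqP => [->|_] //; last exact: disj.
  by move=> vq vi'; rewrite (disjq v i').
by move=> vi vq; rewrite (disjq v i).
Qed.

Lemma exchange_cost p j q :
  total_cost (exchange p j q) + cost (p j).1 (p j).2 = total_cost p + cost q.1 q.2.
Proof.
rewrite /total_cost (bigD1 j) //= [in RHS](bigD1 j) //= /exchange eqxx.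
rewrite (eq_bigr (fun i => cost (p i).1 (p i).2)) => [|i /negPf-> //].
by lia.
Qed.

(* The path entered through the stub at [z] is again breaking and saves the cost of the
   part before [z]; minimality puts that part inside the subdivided edge [w b]. *)
Lemma reroute_suffix p j w b z stub q s1 s2 : cheapest p -> adj w b ->
  P w b = stub ++ z :: q -> (forall i, phi w \notin vertices_of p i) ->
  (forall v i, v \in stub -> v \notin vertices_of p i) ->
  (p j).2 = s1 ++ z :: s2 -> odd (size s2) = (c z == c (last z s2)) ->
  (p j).1 = phi b.
Proof.
move=> [fam best] wb defP wU stubU defj par; have [brk disj] := fam.
have [pj uj /andP[xA lA] intA parj] := brk j.
have [pw uw _ nw cw] := P_spec wb.
have zP : z \in P w b by rewrite defP mem_cat inE eqxx orbT.
rewrite /hpath defP rcons_cat rcons_cons -cat_rcons in pw uw cw.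
have := pj; rewrite defj -cat_rcons cat_path last_rcons => /andP[pj1 pj2].
have pw1 : path e (phi w) (rcons stub z) by move: pw; rewrite cat_path => /andP[].
have uj' : uniq ((p j).1 :: rcons s1 z ++ s2) by rewrite cat_rcons -defj.
have zU : z \in vertices_of p j by rewrite inE defj mem_cat mem_head !orbT.
have s2U v : v \in s2 -> v \in vertices_of p j.
  by move=> vs; rewrite inE defj mem_cat inE vs !orbT.
pose new := (phi w, rcons stub z ++ s2).
have lnew : last (phi w) (rcons stub z ++ s2) = last (p j).1 (p j).2.
  by rewrite last_cat last_rcons defj last_cat.
have newA v : v \in new.1 :: new.2 -> v \in branches -> v = phi w \/ v = last (p j).1 (p j).2.
  rewrite /= inE mem_cat mem_rcons inE -!orbA => /or4P[/eqP->|/eqP->|vs|vs] vA.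
  - by left.
  - by move: vA; rewrite inE (negPf (nw z zP)).
  - by move: vA; rewrite inE (negPf (nw v _)) // defP mem_cat vs.
  case: (intA v (s2U v vs) vA) => [eqv|]; last by right.
  by move: uj'; rewrite /= mem_cat -eqv vs orbT.
have brk_new : breaking_path e c branches new.1 new.2.
  split.
  - by rewrite /= cat_path pw1 last_rcons.
  - rewrite -[_ :: _]/((phi w :: rcons stub z) ++ s2) cat_uniq; apply/and3P; split.
    + by move: uw; rewrite -cat_cons cat_uniq => /and3P[].
    + apply/hasPn => v vs; rewrite /= inE mem_rcons inE; apply/or3P => -[/eqP eqv|/eqP eqv|vstub].
      * by have := wU j; rewrite -eqv (s2U v vs).
      * move: uj'; rewrite -cat_cons cat_uniq => /and3P[_ /hasPn/(_ v vs)].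
        by rewrite /= inE mem_rcons inE eqv eqxx orbT.
      by have := stubU v j vstub; rewrite (s2U v vs).
    by move: uj'; rewrite -cat_cons cat_uniq => /and3P[].
  - by rewrite /= lnew lA andbT inE codom_f.
  - by move=> v /newA h /h; rewrite /= lnew.
  have parw : odd (size stub).+1 = (c (phi w) != c z).
    rewrite -(size_rcons stub z) (coloring_parity (c := c) (x := phi w)) ?last_rcons //.
    by move: cw; rewrite cat_path => /andP[].
  have lz : last (p j).1 (p j).2 = last z s2 by rewrite defj last_cat.
  rewrite [new.1]/= [new.2]/= lnew lz size_cat size_rcons oddD par parw.
  by case: (c (phi w)); case: (c z); case: (c _).
have fam_new : breaking_family (exchange p j new).
  apply: exchange_family => // v i; rewrite /= inE mem_cat mem_rcons inE -!orbA.
  case/or4P => [/eqP->|/eqP->|vs|vs] vi.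
  - by have := wU i; rewrite vi.
  - exact: disj vi zU.
  - by have := stubU v i vs; rewrite vi.
  exact: disj vi (s2U v vs).
have := best _ fam_new; have := exchange_cost p j new.
have cost0 : cost (phi w) (rcons stub z) = 0.
  apply/eqP; rewrite cost_eq0; have := hpath_hedge wb.
  by rewrite defP rcons_cat rcons_cons -cat_rcons cat_path => /andP[].
rewrite {1}defj -cat_rcons !cost_cat cost0 !last_rcons => eq_cost le_cost.
have hp : path hedge (p j).1 (rcons s1 z) by
  rewrite -cost_eq0; move: eq_cost le_cost;
  move: (total_cost _) (total_cost p) (cost (p j).1 _) (cost z s2); clear; lia.
have := rev_path_sym (p j).1 (rcons s1 z) hedge_sym.
rewrite hp last_rcons belast_rcons => hp'.
have lr : last z (rev ((p j).1 :: s1)) = (p j).1 by rewrite rev_cons last_rcons.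
have := @hedge_walk w b z (rev ((p j).1 :: s1)) wb zP hp'.
rewrite lr; case=> //.
- move=> v; rewrite mem_rev inE => /orP[/eqP->//|vs] vA.
  have vj : v \in vertices_of p j by rewrite inE defj mem_cat vs orbT.
  case: (intA v vj vA) => // eqv; move: uj'.
  rewrite cat_rcons -cat_cons cat_uniq => /and3P[_ /hasPn/(_ v) + _].
  rewrite eqv defj last_cat /= mem_last => /(_ isT).
  rewrite inE -[X in X \in s1]/(last z s2) -{2}[last z s2](last_cat (p j).1 s1 (z :: s2)).
  by rewrite -defj -eqv vs orbT.
- rewrite -rev_rcons rev_uniq; move: uj'; rewrite -cat_cons cat_uniq => /and3P[+ _ _].
  by rewrite rcons_cons.
by move=> eqw; have := wU j; rewrite -eqw mem_head.
Qed.

Definition reverse_path (q : T * seq T) : T * seq T := (last q.1 q.2, rev (belast q.1 q.2)).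

(** Reversal keeps the vertices and the cost of a breaking path, so a contact can be analysed from
    either end. *)
Lemma cheapest_reverse p j : cheapest p -> cheapest (exchange p j (reverse_path (p j))).
Proof.
move=> [fam best]; have [brk disj] := fam.
have fam' : breaking_family (exchange p j (reverse_path (p j))).
  apply: exchange_family => //; first exact: breaking_path_rev (brk j).
  move=> v i; rewrite cons_rev_belast mem_rev => vj vi; exact: disj vi vj.
split=> // p' /best; have := exchange_cost p j (reverse_path (p j)).
by rewrite cost_rev => /addIn->.
Qed.

Lemma breaking_ends_neq x r : breaking_path e c branches x r -> x != last x r.
Proof.
case: r => [|y r] [_ ur _ _]; first by rewrite /= eqxx.
by move=> _; apply: contraTneq ur => {1}->; rewrite cons_uniq /= mem_last.
Qed.

(* The colouring of the [j]-th path that alternates along it and agrees with [c] at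
   its first end; it disagrees with [c] at the other end. *)
Definition tree_color p j v : bool := c (p j).1 (+) odd (index v (vertices_of p j)).

(** The vertex [z] cuts a breaking path into two pieces, exactly one of which has the wrong parity
    for [c]. Rerouting the stub into that piece shows that the other piece ends at [phi b]; its
    correct parity gives the colour at [z]. *)
Lemma contact p j w b z stub q : cheapest p -> adj w b -> P w b = stub ++ z :: q ->
  (forall i, phi w \notin vertices_of p i) ->
  (forall v i, v \in stub -> v \notin vertices_of p i) -> z \in vertices_of p j ->
  (phi b = (p j).1 /\ tree_color p j z = c z) \/
  (phi b = last (p j).1 (p j).2 /\ tree_color p j z = ~~ c z).
Proof.
move=> best wb defP wU stubU zj; have [[brk disj] _] := best.
have [pj uj /andP[xA lA] intA parj] := brk j.
have zP : z \in P w b by rewrite defP mem_cat mem_head orbT.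
have zA : z \notin branches by rewrite inE; case: (P_spec wb) => _ _ _ nw _; apply: nw.
have zs : z \in (p j).2.
  by move: zj; rewrite inE => /orP[/eqP zx|//]; rewrite zx xA in zA.
have [s1 [s2 defj]] : exists s1 s2, (p j).2 = s1 ++ z :: s2.
  by case/splitPr: zs => s1 s2; exists s1, s2.
have idx : index z (vertices_of p j) = (size s1).+1.
  move: uj; rewrite /vertices_of defj -cat_cons cat_uniq.
  case/and3P=> _ /hasPn/(_ z (mem_head _ _)) zn _.
  by rewrite index_cat (negPf zn) /= eqxx addn0.
have lz : last (p j).1 (p j).2 = last z s2 by rewrite defj last_cat.
move: parj; rewrite lz defj size_cat /= addnS -addSn oddD => parj.
rewrite /tree_color idx.
have [par2|par2] := eqVneq (odd (size s2)) (c z == c (last z s2)).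
  left; split; first by rewrite (reroute_suffix best wb defP wU stubU defj par2).
  by move: parj; rewrite par2; case: (odd _); case: (c (p j).1); case: (c z); case: (c _).
right; have par1 : odd (size s1).+1 = (c z == c (p j).1).
  by move: parj par2; case: (odd _); case: (odd _); case: (c (p j).1); case: (c z); case: (c _).
split; last by rewrite par1; case: (c _); case: (c _).
have [y [s3 def2]] : exists y s3, s2 = y :: s3.
  by case: (s2) lz => [|y s3] lz'; [rewrite lz' (negPf zA) in lA | exists y, s3].
pose p' := exchange p j (reverse_path (p j)).
have p'j : p' j = reverse_path (p j) by rewrite /p' /exchange eqxx.
have mem' v i : (v \in vertices_of p' i) = (v \in vertices_of p i).
  rewrite /vertices_of /p' /exchange; case: eqP => [->|//].
  by rewrite cons_rev_belast mem_rev.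
rewrite -lz; have := @reroute_suffix p' j w b z stub q (rev (belast y s3)) (rev ((p j).1 :: s1)).
rewrite p'j /= => -> //; first exact: cheapest_reverse.
- by move=> i; rewrite mem'.
- by move=> v i vs; rewrite mem' stubU.
- have -> : (p j).2 = rcons s1 z ++ y :: s3 by rewrite defj def2 cat_rcons.
  by rewrite belast_cat last_rcons belast_rcons rev_cat [belast z _]/= rev_cons cat_rcons.
by rewrite size_rev par1 rev_cons last_rcons.
Qed.
End Families.

(** * The odd minor built from a cheapest family *)

Section OddMinor.
Variables (k : nat) (p : 'I_k -> T * seq T).
Hypothesis best : cheapest p.
Variables (om : option 'I_k -> V) (x_ y_ : 'I_k -> V).
Hypothesis om_inj : injective om.
Hypothesis om_free : forall o i, phi (om o) \notin vertices_of p i.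
Hypothesis first_p : forall j, (p j).1 = phi (x_ j).
Hypothesis last_p : forall j, last (p j).1 (p j).2 = phi (y_ j).
Hypothesis om_adj : forall j,
  Defs.is_inl (om (Some j)) || (Defs.is_inl (x_ j) && Defs.is_inl (y_ j)).

Definition covered : {set T} := [set v | [exists j, v \in vertices_of p j]].
Definition stub w b : seq T := take (find (mem covered) (P w b)) (P w b).
(** The first covered vertex on the subdivided edge; the default of [nth] is reached when no inner
    vertex is covered, and is then the end [phi b]. *)
Definition target w b : T := nth (phi b) (P w b) (find (mem covered) (P w b)).

Lemma coveredP v : reflect (exists j, v \in vertices_of p j) (v \in covered).
Proof. by rewrite inE; apply: existsP. Qed.

Lemma stub_spec w b : (forall v, v \in stub w b -> v \in P w b /\ v \notin covered) /\
  ((exists2 q, P w b = stub w b ++ target w b :: q & target w b \in covered) \/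
   stub w b = P w b /\ target w b = phi b).
Proof.
rewrite /stub /target; have [hasC|noC] := boolP (has (mem covered) (P w b)).
  case: (split_find_nth (phi b) hasC) => z s1 s2 zC s1C.
  split=> [v vs|]; last by left; exists s2; rewrite ?cat_rcons.
  by rewrite mem_cat mem_rcons inE vs orbT; split=> //; apply: (hasPn s1C).
rewrite hasNfind // take_size nth_default //; split=> [v vs|]; last by right.
by split=> //; apply: (hasPn noC).
Qed.

Lemma stub_prefix w b : exists rest,
  rcons (P w b) (phi b) = rcons (stub w b) (target w b) ++ rest.
Proof.
have [_ [[q defP _]|[-> ->]]] := stub_spec w b; last by exists [::]; rewrite cats0.
by exists (rcons q (phi b)); rewrite {1}defP rcons_cat rcons_cons cat_rcons.
Qed.

Lemma stub_path w b : adj w b ->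
  [/\ path e (phi w) (rcons (stub w b) (target w b)), uniq (phi w :: rcons (stub w b) (target w b))
    & path (fun x y => c x != c y) (phi w) (rcons (stub w b) (target w b))].
Proof.
case/P_spec => pe ue _ _ pc; have [rest eqP'] := stub_prefix w b; move: pe ue pc.
rewrite eqP' !cat_path -cat_cons cat_uniq => /andP[-> _] /andP[-> _] /andP[-> _].
by split.
Qed.

Lemma fam_disj i j v : v \in vertices_of p i -> v \in vertices_of p j -> i = j.
Proof. by case: best => [[_ disj] _]; apply: disj. Qed.

Lemma x_in j : phi (x_ j) \in vertices_of p j.
Proof. by rewrite -first_p mem_head. Qed.

Lemma y_in j : phi (y_ j) \in vertices_of p j.
Proof. by rewrite -last_p mem_last. Qed.

Lemma xy_neq j : phi (x_ j) != phi (y_ j).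
Proof.
rewrite -first_p -last_p; case: best => [[brk _] _]; exact: breaking_ends_neq (brk j).
Qed.

Lemma tree_color_last j : tree_color p j (phi (y_ j)) = ~~ c (phi (y_ j)).
Proof.
case: best => [[brk _] _]; have [_ uj _ _ par] := brk j.
rewrite -last_p /tree_color /vertices_of index_last // par.
by case: (c _); case: (c _).
Qed.

Lemma target_end o j b : adj (om o) b -> b = x_ j \/ b = y_ j ->
  target (om o) b \in vertices_of p j /\
  tree_color p j (target (om o) b) = c (target (om o) b) (+) (b == y_ j).
Proof.
move=> wb xyb; have [stubU tg] := stub_spec (om o) b.
have bj : phi b \in vertices_of p j by case: xyb => ->; rewrite ?x_in ?y_in.
case: tg => [[q defP /coveredP[i zi]]|[_ ->]]; last first.
  split=> //; case: xyb => ->; last by rewrite tree_color_last eqxx addbT.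
  rewrite -(inj_eq phi_inj) (negPf (xy_neq j)) addbF.
  by rewrite /tree_color /vertices_of -first_p /= eqxx addbF.
have free v i' : v \in stub (om o) b -> v \notin vertices_of p i'.
  by move=> /stubU[_]; apply: contra => vi; apply/coveredP; exists i'.
have ct := contact best wb defP (om_free o) free zi.
have ij : i = j.
  apply: (fam_disj _ bj); case: ct => [[-> _]|[-> _]]; first by rewrite mem_head.
  exact: mem_last.
rewrite ij in zi ct *; split=> //; move: ct; rewrite last_p first_p.
have xyn := xy_neq j; rewrite -(inj_eq phi_inj).
case=> [[-> ->]|[-> ->]]; first by rewrite (negPf xyn) addbF.
by rewrite eqxx addbT.
Qed.

(** A contact on a subdivided edge between two free branch vertices would make one of them an end of
    a path. *)
Lemma target_free o o' : adj (om o) (om o') -> target (om o) (om o') = phi (om o').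
Proof.
move=> wb; have [stubU [[q defP /coveredP[i zi]]|[_ ->//]]] := stub_spec (om o) (om o').
have free v i' : v \in stub (om o) (om o') -> v \notin vertices_of p i'.
  by move=> /stubU[_]; apply: contra => vi; apply/coveredP; exists i'.
have := contact best wb defP (om_free o) free zi.
have := om_free o' i; case=> + [[eqo _]|[eqo _]]; rewrite eqo.
  by rewrite mem_head.
by rewrite mem_last.
Qed.

(* The tree of [None] may also use the paths towards the free branch vertices. *)
Definition own (o : option 'I_k) b : bool := adj (om o) b && ((o == None) || (phi b \in covered)).

Definition bag (o : option 'I_k) : {set T} :=
  [set v | [|| v == phi (om o), [exists b, own o b && (v \in stub (om o) b)]
             | if o is Some j then v \in vertices_of p j else false]].

(** Paths carry their alternating colouring; outside them the bag of [None] follows [c] and the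
    other bags oppose it. *)
Definition bag_color v : bool :=
  if [pick j | v \in vertices_of p j] is Some j then tree_color p j v
  else c v (+) (v \notin bag None).

Lemma bagP o v : v \in bag o ->
  [\/ v = phi (om o), exists2 b, own o b & v \in stub (om o) b
    | exists2 j, o = Some j & v \in vertices_of p j].
Proof.
rewrite inE => /or3P[/eqP->|/existsP[b /andP[ob vb]]|]; first exact: Or31.
  by apply: Or32; exists b.
by case: o => // j vj; apply: Or33; exists j.
Qed.

Lemma bag_disjoint o o' v : v \in bag o -> v \in bag o' -> o = o'.
Proof.
have branch_stub w o1 b : own o1 b -> phi w \in stub (om o1) b -> False.
  case/andP=> wb _ vs; have [/(_ _ vs)[vP _] _] := stub_spec (om o1) b.
  by have := P_nphi w wb vP; rewrite eqxx.
have stub_cov o1 b j : v \in stub (om o1) b -> v \in vertices_of p j -> False.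
  move=> vs vj; have [/(_ _ vs)[_ /negP vC] _] := stub_spec (om o1) b.
  by apply: vC; apply/coveredP; exists j.
move=> /bagP[vo|[b ob vo]|[j -> vj]] /bagP[vo'|[b' ob' vo']|[j' -> vj']].
- by apply: om_inj; apply: phi_inj; rewrite -vo.
- by rewrite vo in vo'; case: (branch_stub _ _ _ ob' vo').
- by have := om_free o j'; rewrite -vo vj'.
- by rewrite vo' in vo; case: (branch_stub _ _ _ ob vo).
- have [vP _] := (stub_spec (om o) b).1 v vo; have [vP' _] := (stub_spec (om o') b').1 v vo'.
  have /andP[wb cov] := ob; have /andP[wb' cov'] := ob'.
  have nocov o1 : phi (om o1) \in covered -> False.
    by move=> /coveredP[i]; apply/negP.
  (* A subdivided edge used from both ends joins two free branch vertices. Only [None] owns such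
     edges, so both bags are that of [None]. *)
  case: (P_meet wb wb' vP vP') => [[/om_inj->//]|[eq1 eq2]].
  rewrite eq2 in cov; rewrite -eq1 in cov'.
  by case/orP: cov => [/eqP->|/nocov//]; case/orP: cov' => [/eqP->|/nocov//].
- by case: (stub_cov _ _ _ vo vj').
- by have := om_free o' j; rewrite -vo' vj.
- by case: (stub_cov _ _ _ vo' vj).
by rewrite (fam_disj vj vj').
Qed.

Lemma bag_color_covered j v : v \in vertices_of p j -> bag_color v = tree_color p j v.
Proof.
move=> vj; rewrite /bag_color; case: pickP => [i vi|/(_ j)]; last by rewrite vj.
by rewrite (fam_disj vi vj).
Qed.

Lemma bag_color_free o v : v \in bag o -> v \notin covered ->
  bag_color v = c v (+) (o != None).
Proof.
move=> vo vC; rewrite /bag_color; case: pickP => [i vi|_].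
  by case/coveredP: vC; exists i.
congr (_ (+) _); case: (eqVneq o None) => [<-|on]; first by rewrite vo.
by apply: contra on => vn; rewrite (bag_disjoint vo vn).
Qed.

Lemma stub_bag o b v : own o b -> v \in phi (om o) :: stub (om o) b ->
  v \in bag o /\ v \notin covered.
Proof.
move=> ob; rewrite inE => /orP[/eqP->|vs]; last first.
  split; last by have [/(_ _ vs)[]] := stub_spec (om o) b.
  by rewrite inE; apply/or3P; apply: Or32; apply/existsP; exists b; rewrite ob.
by rewrite inE eqxx; split=> //; apply/coveredP => -[i]; apply/negP.
Qed.

Lemma stub_bichromatic o b : own o b ->
  path (bichromatic e bag_color) (phi (om o)) (stub (om o) b).
Proof.
move=> ob; have /andP[wb _] := ob; have [pe _ pc] := stub_path wb.
have pr : path (fun x y => e x y && (c x != c y)) (phi (om o)) (stub (om o) b).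
  by move: pe pc; rewrite !rcons_path => /andP[pe _] /andP[pc _]; rewrite path_relI pe.
have eq_rel : {in phi (om o) :: stub (om o) b &,
    (fun x y => e x y && (c x != c y)) =2 bichromatic e bag_color}.
  move=> x y /(stub_bag ob)[xo xC] /(stub_bag ob)[yo yC]; rewrite /bichromatic.
  rewrite (bag_color_free xo xC) (bag_color_free yo yC); congr (_ && _).
  by case: (c x); case: (c y); case: (o != None).
by rewrite -(eq_in_path eq_rel) //; apply/allP.
Qed.

Lemma vertices_bichromatic j : path (bichromatic e bag_color) (p j).1 (p j).2.
Proof.
case: best => [[brk _] _]; have [pe uj _ _ _] := brk j.
have bc n : n < size (vertices_of p j) ->
    bag_color (nth (p j).1 (vertices_of p j) n) = c (p j).1 (+) odd n.
  move=> lt_n; rewrite (bag_color_covered (mem_nth _ lt_n)) /tree_color.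
  by congr (_ (+) odd _); apply: index_uniq.
apply/(pathP (p j).1) => i lt_i.
have b0 : bag_color (nth (p j).1 ((p j).1 :: (p j).2) i) = c (p j).1 (+) odd i.
  by apply: bc; apply: ltnW.
have b1 : bag_color (nth (p j).1 (p j).2 i) = c (p j).1 (+) odd i.+1 by apply: (bc i.+1).
rewrite /bichromatic (pathP (p j).1 pe i lt_i) b0 b1 /=.
by case: (c _); case: (odd i).
Qed.

Lemma contact_edge o b : own o b ->
  let u := last (phi (om o)) (stub (om o) b) in
  [/\ u \in bag o, e u (target (om o) b),
      bag_color u = c u (+) (o != None) & c u != c (target (om o) b)].
Proof.
move=> ob /=; have /andP[wb _] := ob; have [pe _ pc] := stub_path wb.
have [uo uC] := stub_bag ob (mem_last _ _).
move: pe pc; rewrite !rcons_path => /andP[_ eu] /andP[_ cu].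
by split=> //; apply: bag_color_free uo uC.
Qed.

Lemma own_end j b : adj (om (Some j)) b -> (exists i, b = x_ i \/ b = y_ i) -> own (Some j) b.
Proof.
move=> wb [i xyb]; rewrite /own wb; apply/orP; right; apply/coveredP; exists i.
by case: xyb => ->; rewrite ?x_in ?y_in.
Qed.

Lemma adj_end o v j : phi v \in vertices_of p j ->
  Defs.is_inl (om o) || Defs.is_inl v -> adj (om o) v.
Proof.
move=> vj inl_ov; rewrite /KI_adj inl_ov andbT.
by apply: contraTneq vj => <-; apply: om_free.
Qed.

Lemma om_adj_y j : adj (om (Some j)) (y_ j).
Proof. by apply: adj_end (y_in j) _; case/orP: (om_adj j) => [->//|/andP[_ ->]]; rewrite orbT. Qed.

Lemma bag_connected o : connected_on (bichromatic e bag_color) (bag o).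
Proof.
have bsym := bichromatic_sym e_sym bag_color.
have csym := restr_connect_sym bsym (bag o).
suff toroot v : v \in bag o ->
    connect (restr (bichromatic e bag_color) (bag o)) v (phi (om o)).
  move=> v v' /toroot vo /toroot vo'; apply: connect_trans vo _; by rewrite csym.
case/bagP => [->|[b ob vs]|[j oj vj]]; first exact: connect0.
  have [s1 [s2 defs]] : exists s1 s2, stub (om o) b = rcons s1 v ++ s2.
    by case/splitPr: vs => s1 s2; exists s1, s2; rewrite cat_rcons.
  rewrite csym; have := stub_bichromatic ob; rewrite defs cat_path => /andP[ps _].
  have := path_connect_restr (S := bag o) ps; rewrite last_rcons; apply=> w ws.
  by have [] := @stub_bag o b w ob; rewrite // defs -cat_cons mem_cat ws.
have jo w : w \in vertices_of p j -> w \in bag o.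
  by move=> wj; rewrite oj inE wj !orbT.
have first_root w : w \in vertices_of p j ->
    connect (restr (bichromatic e bag_color) (bag o)) (p j).1 w.
  rewrite inE => /orP[/eqP->|ws]; first exact: connect0.
  have [s1 [s2 defs]] : exists s1 s2, (p j).2 = rcons s1 w ++ s2.
    by case/splitPr: ws => s1 s2; exists s1, s2; rewrite cat_rcons.
  have := vertices_bichromatic j; rewrite defs cat_path => /andP[ps _].
  have := path_connect_restr (S := bag o) ps; rewrite last_rcons; apply=> v' vs'.
  by apply: jo; rewrite /vertices_of defs -cat_cons mem_cat vs'.
(* The path hangs on its free vertex through the end [y_ j]: contacts towards that end are coloured
   against [c], as is the stub, so the connecting edge is bichromatic. *)
have ob : own o (y_ j) by rewrite oj; apply: own_end (om_adj_y j) _; exists j; right.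
have [uo eu au cu] := contact_edge ob.
have [zj az] := target_end (o := o) (b := y_ j) (j := j) (andP ob).1 (or_intror erefl).
set z := target (om o) (y_ j) in eu cu zj az.
have vz : connect (restr (bichromatic e bag_color) (bag o)) v z.
  by apply: connect_trans (first_root z zj); rewrite csym; apply: first_root.
apply: connect_trans vz _; rewrite csym.
have pr : path (bichromatic e bag_color) (phi (om o)) (rcons (stub (om o) (y_ j)) z).
  rewrite rcons_path stub_bichromatic // /bichromatic eu au (bag_color_covered zj) az.
  have -> : o != None by rewrite oj.
  by rewrite eqxx !addbT; move: cu; case: (c _); case: (c _).
have := path_connect_restr (S := bag o) pr; rewrite last_rcons; apply=> w.
rewrite -rcons_cons mem_rcons inE => /orP[/eqP->|/(stub_bag ob)[]//]; exact: jo.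
Qed.

Lemma odd_minor_of_cheapest : odd_Kt_minor e k.+1.
Proof.
apply: (odd_minor_of_bags (bag := bag) (alpha := bag_color)) => //.
- by move=> o; apply/set0Pn; exists (phi (om o)); rewrite inE eqxx.
- exact: bag_connected.
- exact: bag_disjoint.
pose joined o o' := exists x y,
  [/\ x \in bag o, y \in bag o', e x y & bag_color x == bag_color y].
have joined_sym o o' : joined o o' -> joined o' o.
  by move=> [x [y [xo yo' exy /eqP cxy]]]; exists y, x; rewrite e_sym cxy.
have covered_bag j z : z \in vertices_of p j -> z \in bag (Some j).
  by move=> zj; rewrite inE zj !orbT.
(* The stub is coloured against [c], while contacts towards the end [x_ i] agree with [c], so the
   edge between them is monochromatic. *)
have joinS j i : adj (om (Some j)) (x_ i) -> joined (Some j) (Some i).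
  move=> wb; have ob : own (Some j) (x_ i) by apply: own_end wb _; exists i; left.
  have [uo eu au cu] := contact_edge ob.
  have [zi az] := target_end wb (or_introl erefl).
  exists (last (phi (om (Some j))) (stub (om (Some j)) (x_ i))), (target (om (Some j)) (x_ i)).
  split=> //; first exact: covered_bag.
  rewrite au (bag_color_covered zi) az -(inj_eq phi_inj) (negPf (xy_neq i)).
  by move: cu; case: (c _); case: (c _).
have joinN j : joined None (Some j).
  (* The tree of [None] follows [c], so it sees contacts towards [y_ j] monochromatically. If [y_ j]
     is not adjacent, the free vertex of [j] lies in the complete part and is reached directly. *)
  have [wy|nwy] := boolP (adj (om None) (y_ j)).
    have ob : own None (y_ j) by rewrite /own wy.
    have [uo eu au cu] := contact_edge ob.
    have [zj az] := target_end wy (or_intror erefl).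
    exists (last (phi (om None)) (stub (om None) (y_ j))), (target (om None) (y_ j)).
    split=> //; first exact: covered_bag.
    by rewrite au (bag_color_covered zj) az eqxx; move: cu; case: (c _); case: (c _).
  have inlj : Defs.is_inl (om (Some j)).
    case/orP: (om_adj j) => // /andP[_ yl]; case/negP: nwy.
    by apply: adj_end (y_in j) _; rewrite yl orbT.
  have ww : adj (om None) (om (Some j)).
    by rewrite /KI_adj inlj orbT andbT; apply/eqP => /om_inj.
  have ob : own None (om (Some j)) by rewrite /own ww.
  have [uo eu au cu] := contact_edge ob; rewrite (target_free ww) in eu cu.
  exists (last (phi (om None)) (stub (om None) (om (Some j)))), (phi (om (Some j))).
  have mo : phi (om (Some j)) \in bag (Some j) by rewrite inE eqxx.
  split=> //; rewrite au (bag_color_free mo).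
    by move: cu; case: (c _); case: (c _).
  by apply/coveredP => -[i]; apply/negP.
move=> [j|] [i|] // ne; last by apply: joinN.
  have [/orP jl|nj] := boolP (Defs.is_inl (om (Some j)) || Defs.is_inl (x_ i)).
    by apply: joinS; apply: adj_end (x_in i) _; apply/orP.
  (* If the free vertex of [j] is outside the complete part, [om_adj] puts [x_ j] inside it, and the
     roles of [i] and [j] are exchanged. *)
  move: nj; rewrite negb_or => /andP[nj ni].
  apply: joined_sym; apply: joinS; apply: adj_end (x_in j) _.
  by case/orP: (om_adj j) nj => [->//|/andP[-> _]]; rewrite orbT.
by apply: joined_sym; apply: joinN.
Qed.
End OddMinor.

Lemma odd_minor_of_breaking_paths : 2 <= t -> s = 2 * t - 2 ->
  disjoint_breaking_paths e c branches t.-1 -> odd_Kt_minor e t.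
Proof.
move=> t2 es fam0; have [p best] := ex_min_measure (@total_cost t.-1) fam0.
have [[brk disj] _] := best.
have ends j : exists xy : V * V, (p j).1 = phi xy.1 /\ last (p j).1 (p j).2 = phi xy.2.
  have [_ _ /andP[]] := brk j; rewrite !inE => /codomP[x ex] /codomP[y ey] _ _.
  by exists (x, y).
have [xy xyP] := fin_all_exists ends.
pose x_ j := (xy j).1; pose y_ j := (xy j).2.
have first_p j : (p j).1 = phi (x_ j) by case: (xyP j).
have last_p j : last (p j).1 (p j).2 = phi (y_ j) by case: (xyP j).
have x_in j : phi (x_ j) \in vertices_of p j by rewrite -first_p mem_head.
have y_in j : phi (y_ j) \in vertices_of p j by rewrite -last_p mem_last.
pose E := (x_ @: setT) :|: (y_ @: setT).
pose K : {set V} := [set v | Defs.is_inl v].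
(* These paths have an end in the edgeless part and must receive a free vertex of the complete
   part. *)
pose B := [set j | ~~ (Defs.is_inl (x_ j) && Defs.is_inl (y_ j))].
have cV : #|V| = s + t by rewrite card_sum !card_ord.
have cK : #|~: K| <= t.
  have cI : #|(inr : 'I_t -> V) @: setT| = t.
    by rewrite card_imset ?cardsT ?card_ord // => i j [].
  rewrite -[leqRHS]cI; apply/subset_leq_card/subsetP => -[i|i]; rewrite !inE // => _.
  exact: imset_f.
have cE : #|E| <= 2 * t.-1.
  apply: leq_trans (leq_card_setU _ _) _; rewrite mul2n -addnn.
  by apply: leq_add; apply: leq_trans (leq_imset_card _ _) _; rewrite cardsT card_ord.
have cB : #|B| <= #|E :\: K|.
  pose out j := if Defs.is_inl (x_ j) then y_ j else x_ j.
  have out_in j : phi (out j) \in vertices_of p j by rewrite /out; case: ifP.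
  have out_inj : injective out.
    by move=> i j eq_ij; apply: (disj _ _ (phi (out i))); rewrite ?out_in // eq_ij out_in.
  rewrite -(card_imset B out_inj); apply/subset_leq_card/subsetP => _ /imsetP[j jB ->].
  rewrite !inE; apply/andP; split.
    by move: jB; rewrite inE /out; case: ifP => //= ->.
  by apply/orP; rewrite /out; case: ifP => _; [right | left]; apply: imset_f.
have [om [om_inj omW omB]] : exists om : option 'I_t.-1 -> V,
    [/\ injective om, (forall o, om o \in ~: E) & forall j, j \in B -> om (Some j) \in ~: E :&: K].
  apply: injective_assignment; first exact: subsetIl.
    have := cardsID K (~: E); have := cardsID E (~: K); have := cardsC E.
    move: cB cK cE; rewrite !setDE [~: K :&: E]setIC [~: K :&: ~: E]setIC cV.
    by move: es;
      move: #|B| #|~: K| #|E| #|~: E| #|E :&: _| #|~: E :&: ~: K| #|~: E :&: K| t2; clear; lia.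
  by rewrite card_ord; move: (cardsC E) cE es t2; rewrite cV; move: #|E| #|~: E|; clear; lia.
have om_free o i : phi (om o) \notin vertices_of p i.
  apply/negP => oi; have [_ _ _ intA _] := brk i.
  have := omW o; rewrite inE => /negP; apply; rewrite inE; apply/orP.
  have /(intA _ oi) : phi (om o) \in branches by rewrite inE codom_f.
  rewrite first_p -(first_p i) last_p first_p.
  by case=> /phi_inj->; [left | right]; apply: imset_f.
have := odd_minor_of_cheapest best om_inj om_free first_p last_p.
rewrite prednK; last exact: ltnW.
apply=> j; have [jB|] := boolP (j \in B); last by rewrite inE negbK => ->; rewrite orbT.
by have := omB j jB; rewrite !inE => /andP[_ ->].
Qed.
End Subdivision.


(** * The bipartite block outside the hitting set *)

Theorem theorem3p6 (T : finType) (e : rel T) (t : nat) :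
  2 <= t ->
  symmetric e -> irreflexive e ->
  ~ odd_Kt_minor e t ->
  bip_subdivision e (@KI_adj (2 * t - 2) t) ->
  exists X : {set T}, #|X| <= 2 * t - 4 /\
    exists B : {set T}, [/\ is_block_minus e X B, bipartite_on e B & t + 3 <= #|B|].
Proof.
move=> t2 e_sym e_irr no_minor [phi [P [c [phi_inj P_spec P_disj]]]].
have no_paths : ~ disjoint_breaking_paths e c (branches phi) t.-1.
  by move=> fam; apply/no_minor/(odd_minor_of_breaking_paths e_sym phi_inj P_spec P_disj).
have [X [leX hitX]] := breaking_path_duality e_sym no_paths.
have {}leX : #|X| <= 2 * t - 4 by lia.
have t0 : 0 < t by apply: ltnW.
have [le_core [a [b [ab aC bC]]]] := core_card phi_inj P_spec t2 erefl leX.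
have sX := core_subset phi P X.
have conn : connected_on e (core phi P X).
  have -> : core phi P X = core phi P X :\: X.
    by apply/esym/setDidPl; rewrite disjoints_subset.
  apply: (core_connected e_sym phi_inj P_spec P_disj t0) => //; first by lia.
  by move=> x y; rewrite setDv inE.
have cut : no_cut_vertex e (core phi P X).
  (* Together with [v], the hitting set has at most [2 * t - 3] vertices, still fewer than the
     [2 * t - 2] disjoint routes. *)
  move=> v vC; have -> : core phi P X :\ v = core phi P X :\: (v |: X).
    apply/setP => x; rewrite in_setD1 in_setD in_setU1 negb_or -andbA; congr (_ && _).
    by apply/idP/andP => [xC|[]//]; split=> //; have := subsetP sX x xC; rewrite inE.
  have vX : v \notin X by have := subsetP sX v vC; rewrite inE.
  apply: (core_connected e_sym phi_inj P_spec P_disj t0); first exact: subsetUr.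
    by rewrite cardsU1 vX; lia.
  move=> x y; rewrite !inE => /andP[/negPf->]; rewrite orbF => /eqP-> /andP[/negPf->].
  by rewrite orbF => /eqP.
have C0 : core phi P X != set0 by apply/set0Pn; exists (phi a).
have [B sB blockB] := block_exists sX C0 conn cut.
exists X; split=> //; exists B; split=> //.
  have brA v : phi v \in branches phi by rewrite inE codom_f.
  have phi_ab : phi a != phi b by rewrite (inj_eq phi_inj).
  exact: (block_bipartite e_sym e_irr hitX blockB (brA a) (brA b)
    (subsetP sB _ aC) (subsetP sB _ bC) phi_ab).
exact: leq_trans le_core (subset_leq_card sB).
Qed.
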